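(* Let $k=0$ or $k\ge 2$. There is a constant $\delta>0$ such that any $[n]$-way branching program of time $T$ and space $S$ that computes $F_k^{\boxplus n}$ with error at most $\eta$, where $0<\eta<1-2^{-\delta S}$, for input chosen uniformly at random from $[n]^{2n-1}$, must have $T\cdot S\in\Omega(n^2)$. The same lower bound holds for $(F_0\bmod 2)^{\boxplus n}$.
   Context: For $a\in D^\ell$, $F_k(a)=\sum_{i} f_i^k$ where $f_i$ is the number of occurrences of symbol $i$ in $a$ and the sum ranges over symbols occurring in $a$; so $F_0(a)$ is the number of distinct symbols. For a function $F$ on length-$n$ strings, $F^{\boxplus n}(x)=(F(x_i,\ldots,x_{i+n-1}))_{i=1}^n$ for $x\in[n]^{2n-1}$. An $[n]$-way branching program on inputs in $[n]^{2n-1}$ with $n$ outputs is a directed acyclic graph with a source node and sink nodes; each non-sink node is labeled by an input index and has one out-edge for each value in $[n]$, and edges may be labeled with assignments of values to some of the outputs. On input $x$ the computation follows the path from the source determined by the queried values, and the output is the collection of assignments along that path. Time $T$ is the length of the longest source-sink path and space $S$ is $\log_2$ of the number of nodes. It computes $F^{\boxplus n}$ with error at most $\eta$ under the uniform distribution if its output equals $F^{\boxplus n}(x)$ for all but an $\eta$ fraction of $x\in[n]^{2n-1}$.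
   Formalization: The formal statement also assumes η < 1 − 2^(−δn), automatic when S ≤ n; without it the claim fails: for F_0 mod 2, a query tree of depth about Kn/log n that always outputs one fixed vector has S about Kn, error at most 1 − 2^(−n) and T·S = o(n²). *)

(* Defs.v *)
From HB Require Import structures.
From mathcomp Require Import all_boot all_order all_algebra.
From mathcomp Require Import all_classical all_reals all_analysis.

Set Implicit Arguments.
Unset Strict Implicit.
Unset Printing Implicit Defensive.

Import Order.TTheory GRing.Theory Num.Theory.

Local Open Scope ring_scope.

Definition freq_moment (k : nat) (D : eqType) (a : seq D) : nat :=
  (\sum_(d <- undup a) count_mem d a ^ k)%N.

(* Windows are indexed from 0: window i is x_i, ..., x_(i+n-1) for i < n. *)
Definition sliding_window (D : Type) (V : Type) (n : nat) (F : seq D -> V)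
    (x : (2 * n - 1)%N.-tuple D) (i : 'I_n) : V :=
  F (take n (drop i x)).

(* D-way branching programs on N inputs, with M outputs taking values in V.   *)
(* A node v with [bp_query v = None] is a sink, and then [bp_child v] and     *)
(* [bp_emit v] are meaningless. The edge leaving v for the value d goes to    *)
(* [bp_child v d]; [bp_emit v d] lists the (possibly many, possibly no)       *)
(* output assignments labeling it.                                            *)
Definition bp_rel (D : finType) (N : nat) (node : finType)
    (query : node -> option 'I_N) (child : node -> D -> node) : rel node :=
  [rel u v | (query u != None) && [exists d, child u d == v]].

Record branching_program (D : finType) (N M : nat) (V : eqType) := BP {
  bp_node : finType;
  bp_source : bp_node;
  bp_query : bp_node -> option 'I_N;
  bp_child : bp_node -> D -> bp_node;
  bp_emit : bp_node -> D -> seq ('I_M * V);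
  bp_acyclic : forall u v, bp_rel bp_query bp_child u v ->
    ~~ connect (bp_rel bp_query bp_child) v u;
  bp_sourceP : forall v,
    (v == bp_source) = ~~ [exists u, bp_rel bp_query bp_child u v]
}.

Section BranchingProgram.
Variables (D : finType) (N M : nat) (V : eqType).
Variable B : branching_program D N M V.

Definition bp_edge : rel (bp_node B) := bp_rel (@bp_query _ _ _ _ B) (@bp_child _ _ _ _ B).

Definition bp_sink (v : bp_node B) : bool := bp_query v == None.

(* By acyclicity a path has fewer edges than there are nodes, so the bound on *)
(* t below excludes no path.                                                  *)
Definition bp_time : nat :=
  (\max_(t < #|bp_node B| |
      [exists p : t.-tuple (bp_node B),
         path bp_edge (bp_source B) p && bp_sink (last (bp_source B) p)]) t)%N.

Definition bp_space (R : realType) : R := ln (#|bp_node B|%:R) / ln 2.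

Fixpoint bp_run (fuel : nat) (v : bp_node B) (x : N.-tuple D) :
    seq ('I_M * V) :=
  if fuel is m.+1 then
    if bp_query v is Some i then
      bp_emit v (tnth x i) ++ bp_run m (bp_child v (tnth x i)) x
    else [::]
  else [::].

(* By acyclicity this fuel suffices to reach a sink. *)
Definition bp_output (x : N.-tuple D) : seq ('I_M * V) :=
  bp_run #|bp_node B| (bp_source B) x.

(* The set of assignments made along the path of x is the graph of g x: every *)
(* output is assigned, and no assignment is wrong.                            *)
Definition bp_correct (g : N.-tuple D -> 'I_M -> V) (x : N.-tuple D) : bool :=
  [forall i, (i, g x i) \in bp_output x] &&
  all (fun o => o.2 == g x o.1) (bp_output x).

Definition bp_error (R : realType) (g : N.-tuple D -> 'I_M -> V) : R :=
  #|[set x | ~~ bp_correct g x]|%:R / #|{: N.-tuple D}|%:R.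

End BranchingProgram.

(* T * S is in Omega(n^2) for computing F over sliding windows with error     *)
(* less than 1 - 2^(-delta S); c and n0 are the constants hidden by Omega.    *)
(* The bound eta < 1 - 2^(-delta n) follows from the preceding one if S <= n. *)
(* It cannot be dropped when S > n: if F is 0/1-valued, some fixed output     *)
(* vector is correct with probability at least 2^(-n), so for K > 1 / delta a *)
(* full query tree of depth about K n / log2 n that always outputs this       *)
(* vector has S about K n, error at most 1 - 2^(-n) < 1 - 2^(-delta S), and   *)
(* T * S about K^2 n^2 / log2 n.                                              *)
Definition sliding_TS_lower_bound (R : realType)
    (F : forall n : nat, seq 'I_n -> nat) (delta : R) : Prop :=
  exists c : R, 0 < c /\ exists n0 : nat,
    forall n : nat, (n0 <= n)%N ->
    forall (B : branching_program 'I_n (2 * n - 1) n nat) (eta : R),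
      0 < eta ->
      eta < 1 - 2 `^ (- (delta * bp_space B R)) ->
      eta < 1 - 2 `^ (- (delta * n%:R)) ->
      bp_error B R (sliding_window (F n)) <= eta ->
      c * n%:R ^+ 2 <= (bp_time B)%:R * bp_space B R.

(* Main.v *)
(* Split the program into stages of n/8 queries. A position pair (l, r) with
   r = l + 1 < n is hard for x if x_l and x_r are distinct values occurring
   nowhere else in x. Fix everything except a set P of about n/8 positions in
   the second half that a stage has not queried, and exchange the values
   u = x_l and v = x_r on P. A window that contains both or none of l and r is
   only renamed and permuted, so F is unchanged there; the only other window is
   the one starting at r, which contains v but not u. If P meets {u, v} exactly
   once, that window changes from [v, u, ...] to [v, v, ...], which changes F.
   So each hard output of a stage is an independent coin with constant
   probability, and a stage is right about m hard outputs with probability at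
   most (127/128)^m. Outside an exponentially small set of inputs linearly many
   pairs are hard, so some stage must produce n^2/T hard outputs up to a
   constant factor; a union bound over the stage's starting node concludes. *)

Require Import Defs.
From HB Require Import structures.
From mathcomp Require Import all_boot all_order all_algebra.
From mathcomp Require Import all_classical all_reals all_analysis.
From mathcomp Require Import perm zify ring lra.

Set Implicit Arguments.
Unset Strict Implicit.
Unset Printing Implicit Defensive.

Import Order.TTheory GRing.Theory Num.Theory.

Local Open Scope ring_scope.

(** * Resampling some coordinates of a uniform tuple *)

Section Overwrite.
Variables (D : finType) (N : nat).
Implicit Types (x y : N.-tuple D) (p : 'I_N) (d : D) (Q : {set 'I_N}).

Definition overwrite Q y x : N.-tuple D :=
  [tuple if p \in Q then tnth y p else tnth x p | p < N].

Definition update x p d : N.-tuple D :=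
  [tuple if i == p then d else tnth x i | i < N].

Lemma tnth_overwrite Q y x p :
  tnth (overwrite Q y x) p = if p \in Q then tnth y p else tnth x p.
Proof. by rewrite tnth_mktuple. Qed.

Lemma tnth_update x p d i :
  tnth (update x p d) i = if i == p then d else tnth x i.
Proof. by rewrite tnth_mktuple. Qed.

(** Exchanging the coordinates in [Q] between the two tuples is an involution [s] on pairs, and
    overwriting after this exchange gives back the second tuple. *)
Lemma sum_overwrite (V : nmodType) Q (f : N.-tuple D -> V) :
  \sum_y \sum_x f (overwrite Q y x) = (\sum_x f x) *+ #|{: N.-tuple D}|.
Proof.
rewrite pair_big /=.
pose s (u : N.-tuple D * N.-tuple D) := (overwrite Q u.2 u.1, overwrite Q u.1 u.2).
have sK : involutive s.
  move=> [y x]; rewrite /s /=; congr pair; apply: eq_from_tnth => p;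
  by rewrite !tnth_overwrite; case: (p \in Q).
rewrite (reindex_inj (inv_inj sK)) /=.
rewrite -(pair_big xpredT xpredT (fun y x => f (overwrite Q (overwrite Q x y) (overwrite Q y x)))) /=.
rewrite -sumr_const; apply: eq_bigr => y _; apply: eq_bigr => x _; congr f.
by apply: eq_from_tnth => p; rewrite !tnth_overwrite; case: (p \in Q).
Qed.

Lemma sum_update (V : nmodType) p (f : N.-tuple D -> V) :
  \sum_x \sum_d f (update x p d) = (\sum_x f x) *+ #|D|.
Proof.
rewrite pair_big /=.
pose s (u : N.-tuple D * D) := (update u.1 p u.2, tnth u.1 p).
have sE u : update (s u).1 p (s u).2 = u.1.
  apply: eq_from_tnth => i; rewrite !tnth_update; by case: eqP => [->|].
have sK : involutive s.
  by move=> [x d]; rewrite {1}/s sE /= tnth_update eqxx.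
rewrite (reindex_inj (inv_inj sK)) /=.
under eq_bigr => u _ do rewrite sE.
rewrite -(pair_big xpredT xpredT (fun x d => f x)) /= -sumrMnl.
by apply: eq_bigr => x _; rewrite sumr_const.
Qed.

(** A bound that holds for every way of fixing the larger set [Q'] survives averaging over the
    positions of [Q'] outside [Q]. This is how further positions get conditioned on. *)
Lemma sum_overwrite_le (R : realType) Q Q' x0 (f : N.-tuple D -> R) B :
    Q \subset Q' -> (forall y, \sum_x f (overwrite Q' y x) <= B) ->
  \sum_x f (overwrite Q x0 x) <= B.
Proof.
move=> sQ fB.
have n0 : (0 < #|{: N.-tuple D}|)%N by apply/card_gt0P; exists x0.
rewrite -(ler_pMn2r n0) -(sum_overwrite Q') -sumr_const.
apply: (le_trans _ (ler_sum _ (fun y _ => fB (overwrite Q x0 y)))).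
apply: ler_sum => y _; apply: ler_sum => x _; rewrite le_eqVlt; apply/orP; left; apply/eqP.
congr f; apply: eq_from_tnth => p; rewrite !tnth_overwrite.
by case: (boolP (p \in Q)) => // pQ; rewrite (fintype.subsetP sQ).
Qed.

End Overwrite.

(** * Occupancy weights of disjoint value classes *)

Section Balls.
Variables (R : realType) (D : finType) (N : nat).
Implicit Types (P : {set 'I_N}) (A : {set D}) (x : N.-tuple D).

Definition hits P A x : nat := #|[set p in P | tnth x p \in A]|.

Lemma hits_update P A x p d : p \in P ->
  hits P A (update x p d) = ((d \in A) + hits (P :\ p) A x)%N.
Proof.
move=> pP; rewrite /hits (cardsD1 p) inE pP tnth_update eqxx /=; congr addn.
by apply: eq_card => q; rewrite !inE tnth_update; case: eqP.
Qed.

(** A value lies in at most one class, so at most one factor differs from 1 and the product is 1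
    plus a sum. *)
Lemma sum_prod_disjoint (J : finType) (I : {set J}) (A : J -> {set D}) (r : J -> R) :
    {in I &, forall i j, i != j -> [disjoint A i & A j]} ->
  \sum_d \prod_(j in I) (if d \in A j then r j else 1) =
  #|D|%:R + \sum_(j in I) (r j - 1) *+ #|A j|.
Proof.
move=> dA.
have E d : \prod_(j in I) (if d \in A j then r j else 1) =
    1 + \sum_(j in I) (if d \in A j then r j - 1 else 0).
  have [/existsP[i /andP[iI dAi]]|/existsPn nA] := boolP [exists i, (i \in I) && (d \in A i)].
    have nd j : (j \in I) && (j != i) -> (d \in A j) = false.
      by case/andP=> jI ji; apply: (disjointFl (dA _ _ jI iI ji)).
    rewrite (bigD1 i) //= dAi big1; last by move=> j /nd ->.
    rewrite [in RHS](bigD1 i) //= dAi big1; last by move=> j /nd ->.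
    by rewrite mulr1 addr0 addrC subrK.
  have nd j : j \in I -> (d \in A j) = false.
    by move=> jI; have := nA j; rewrite jI /= => /negbTE.
  by rewrite !big1 ?addr0 // => j /nd ->.
under eq_bigr => d _ do rewrite E.
rewrite big_split /= sumr_const exchange_big /=; congr (_ + _).
by apply: eq_bigr => j _; rewrite -big_mkcond /= sumr_const.
Qed.

(* Positions of P are averaged out one at a time; phi t c is the weight of a
   value class hit c times when t positions have been averaged. The values of
   the classes being disjoint, one step multiplies the product of weights by
   1 + sum_j (2 / n) (phi t c_j.+1 / phi t c_j - 1), at most the product of the
   exponentials in the hypothesis. *)
Lemma sum_prod_hits_le (J : finType) (I : {set J}) (A : J -> {set D})
    (phi : nat -> nat -> R) s P :
    (0 < #|D|)%N ->
    {in I &, forall i j, i != j -> [disjoint A i & A j]} ->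
    {in I, forall j, #|A j| = 2%N} ->
    (forall t c, (t <= s + #|P|)%N -> 0 < phi t c) ->
    (forall t c, (t < s + #|P|)%N ->
      phi t c * expR (2 / #|D|%:R * (phi t c.+1 / phi t c - 1)) <= phi t.+1 c) ->
  \sum_(x : N.-tuple D) \prod_(j in I) phi s (hits P (A j) x) <=
  #|{: N.-tuple D}|%:R * phi (s + #|P|)%N 0%N ^+ #|I|.
Proof.
move=> D0 dA A2 phi0 phiS.
have [k kP] : exists k, k = #|P| by exists #|P|.
rewrite -kP in phi0 phiS *.
elim: k => [|k IH] in s P kP phi0 phiS *.
  have P0 : P = finset.set0 by apply/eqP; rewrite -cards_eq0 -kP.
  under eq_bigr => x _.
    under eq_bigr => j _.
      have -> : hits P (A j) x = 0%N by apply: eq_card0 => p; rewrite P0 !inE.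
    over.
    rewrite prodr_const; over.
  by rewrite sumr_const addn0 mulr_natl.
have [p pP] : exists p, p \in P by apply/card_gt0P; rewrite -kP.
rewrite -(ler_pMn2r D0) -(sum_update p).
have kP' : k = #|P :\ p| by move: kP; rewrite (cardsD1 p) pP => -[].
rewrite -addSnnS.
apply: (@le_trans _ _ ((\sum_(x : N.-tuple D) \prod_(j in I) phi s.+1 (hits (P :\ p) (A j) x)) *+ #|D|)); last first.
  rewrite ler_pMn2r //; apply: IH => // t c ts; [apply: phi0 | apply: phiS]; lia.
rewrite -sumrMnl; apply: ler_sum => x _.
have phis c : 0 < phi s c by apply: phi0; lia.
pose c j := hits (P :\ p) (A j) x.
have D0R : (0 : R) < #|D|%:R by rewrite ltr0n.
pose r j := phi s (c j).+1 / phi s (c j).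
apply: (@le_trans _ _ ((\prod_(j in I) phi s (c j)) *
    (\sum_d \prod_(j in I) (if d \in A j then r j else 1)))).
  rewrite big_distrr /=; apply: ler_sum => d _.
  rewrite -big_split /= le_eqVlt; apply/orP; left; apply/eqP; apply: eq_bigr => j _.
  rewrite hits_update // /r -/(c j); case: (d \in A j); rewrite ?mulr1 //.
  by rewrite add1n mulrC divfK // gt_eqF.
rewrite sum_prod_disjoint //.
apply: (@le_trans _ _ ((\prod_(j in I) phi s (c j)) *
    (#|D|%:R * expR (\sum_(j in I) (2 / #|D|%:R * (r j - 1)))))).
  rewrite ler_wpM2l //; first by apply: prodr_ge0 => j _; exact: ltW.
  apply: le_trans (ler_wpM2l (ltW D0R) (expR_ge1Dx _)).
  rewrite mulrDr mulr1 lerD2l big_distrr /=; apply: ler_sum => j jI.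
  rewrite A2 // -mulr_natr le_eqVlt; apply/orP; left; apply/eqP.
  by field; rewrite gt_eqF.
rewrite expR_sum mulrCA -big_split /= -[leRHS]mulr_natl ler_wpM2l ?ler0n //.
apply: ler_prod => j jI; apply/andP; split.
  by rewrite mulr_ge0 ?expR_ge0 // ltW.
by apply: phiS; lia.
Qed.

End Balls.

(** Replaces independence of the events [ok j]. The map [sw i] leaves every factor but [ok i]
    unchanged, so averaging over [x] and [sw i x] turns [ok i] into at most [w i]; this is done for
    one index after the other. *)
Lemma sum_prod_flip_le (R : realType) (X J : finType) (I : {set J})
    (ok w : J -> X -> R) (sw : J -> X -> X) :
    (forall j, injective (sw j)) ->
    (forall j x, 0 <= ok j x) -> (forall j x, 0 <= w j x) ->
    {in I &, forall i j, i != j -> forall x, ok i (sw j x) = ok i x} ->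
    {in I &, forall i j x, w i (sw j x) = w i x} ->
    {in I, forall j x, ok j x + ok j (sw j x) <= 2 * w j x} ->
  \sum_x \prod_(j in I) ok j x <= \sum_x \prod_(j in I) w j x.
Proof.
move=> swI ok0 w0 okS wS okw.
(* [K] is the set of indices that still carry [ok]; the others have already been turned into [w]. *)
suff H (K : {set J}) : K \subset I -> \sum_x ((\prod_(j in K) ok j x) *
    \prod_(j in I :\: K) w j x) <= \sum_x \prod_(j in I) w j x.
  by have := H I (fintype.subxx _); rewrite finset.setDv;
     under eq_bigr => x _ do rewrite big_set0 mulr1.
have [k kK] : exists k, k = #|K| by exists #|K|.
elim: k => [|k IH] in K kK * => sK.
  have -> : K = finset.set0 by apply/eqP; rewrite -cards_eq0 -kK.
  by rewrite finset.setD0; under eq_bigr => x _ do rewrite big_set0 mul1r.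
have [i iK] : exists i, i \in K by apply/card_gt0P; rewrite -kK.
have iI : i \in I by apply: (fintype.subsetP sK).
have kK' : k = #|K :\ i| by move: kK; rewrite (cardsD1 i) iK => -[].
apply: le_trans (IH _ kK' (fintype.subset_trans (subD1set _ _) sK)).
pose rest x := (\prod_(j in K :\ i) ok j x) * \prod_(j in I :\: K) w j x.
have rest0 x : 0 <= rest x by rewrite mulr_ge0 // prodr_ge0.
have restS x : rest (sw i x) = rest x.
  congr (_ * _); apply: eq_bigr => j; rewrite !inE.
    by case/andP=> ji jK; apply: okS => //; apply: (fintype.subsetP sK).
  by case/andP=> _ jI; apply: wS.
have EL x : (\prod_(j in K) ok j x) * \prod_(j in I :\: K) w j x = ok i x * rest x.
  by rewrite (big_setD1 i) //= -mulrA.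
have ER x : (\prod_(j in K :\ i) ok j x) * \prod_(j in I :\: (K :\ i)) w j x = w i x * rest x.
  rewrite (big_setD1 i (A := I :\: _)) /=; last by rewrite !inE eqxx.
  rewrite mulrCA; congr (_ * (_ * _)); apply: eq_bigl => j; rewrite !inE.
  by case: (eqVneq j i) => [->|] /=; rewrite ?iK.
under eq_bigr => x _ do rewrite EL.
under [leRHS]eq_bigr => x _ do rewrite ER.
rewrite -(ler_pM2l (_ : 0 < 2)) //.
have -> : 2 * (\sum_x ok i x * rest x) = \sum_x (ok i x + ok i (sw i x)) * rest x.
  rewrite mulr_natl mulr2n {2}(reindex_inj (swI i)) /= -big_split /=.
  by apply: eq_bigr => x _; rewrite restS mulrDl.
rewrite big_distrr /=; apply: ler_sum => x _.
by rewrite [2 * _]mulrA; apply: ler_wpM2r => //; exact: okw.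
Qed.

(** Turns the exponential condition on the weights [phi] into a polynomial one. *)
Lemma expR_le_inv (R : realType) (z : R) : z < 1 -> expR z <= (1 - z)^-1.
Proof.
move=> z1; rewrite -[expR z]invrK -expRN lef_pV2 ?posrE ?expR_gt0 ?subr_gt0 //.
exact: expR_ge1Dx.
Qed.

(** * Random positions meeting disjoint pairs of values *)

Section PairOccupancy.
Variables (R : realType) (D : finType) (N : nat) (J : finType).
Variables (I : {set J}) (A : J -> {set D}).
Hypothesis D8 : (8 <= #|D|)%N.
Hypothesis dA : {in I &, forall i j, i != j -> [disjoint A i & A j]}.
Hypothesis A2 : {in I, forall j, #|A j| = 2%N}.

Let e : R := #|D|%:R^-1.

Let e_gt0 : 0 < e. Proof. by rewrite invr_gt0 ltr0n; lia. Qed.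
Let e_le : e <= 1 / 8.
Proof. by rewrite div1r lef_pV2 ?posrE ?ltr0n ?ler_nat //; lia. Qed.

(** A pair of values escapes 2n random draws with probability bounded below. The factor 1/2 for each
    pair that escapes makes the sum an exponential moment of the number of such pairs. *)
Lemma sum_not_hit_le (P : {set 'I_N}) : (#|P| <= 2 * #|D|)%N ->
  \sum_(x : N.-tuple D) \prod_(j in I) (if hits P (A j) x == 0%N then 2^-1 else 1) <=
  #|{: N.-tuple D}|%:R * (1 - expR (-16) / 2 : R) ^+ #|I|.
Proof.
move=> P2.
(* The sharp weight at c = 0 is about 1 - exp (- 2 t / n) / 2; this one is
   larger. *)
pose phi (t c : nat) : R := if c == 0%N then 1 - (1 - 4 * e) ^+ t / 2 else 1.
have e1 : 0 <= 1 - 4 * e <= 1 by move: e_gt0 e_le; lra.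
have q01 t : 0 <= (1 - 4 * e) ^+ t <= 1.
  by case/andP: e1 => ? ?; rewrite exprn_ge0 //= exprn_ile1.
have D0 : (0 < #|D|)%N by lia.
have := @sum_prod_hits_le R D N J I A phi 0%N P => /(_ D0 dA A2 _ _)/le_trans H.
have E x j : (if hits P (A j) x == 0%N then 2^-1 else 1) = phi 0%N (hits P (A j) x).
  by rewrite /phi expr0; case: ifP => _ //; lra.
under eq_bigr => x _ do under eq_bigr => j _ do rewrite E.
apply: H.
- move=> t c _; rewrite /phi; case: (c == 0%N); rewrite ?ltr01 //; have := q01 t; lra.
- move=> t c _; rewrite /phi; case: c => [|c] /=; last by rewrite divr1 subrr mulr0 expR0 mulr1.
  (* With [b] the weight at 0 and [z] the exponent, the claim is that b exp(z) is at most b + 4e(1 -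
     b). Since bz = 2e(1 - b), bounding exp(z) by 1/(1 - z) leaves only 1 - z >= 1/2 to check. *)
  rewrite exprS; move: (q01 t); set q := _ ^+ t => q01t; rewrite -/e.
  set b := 1 - q / 2; have b2 : 1 / 2 <= b by rewrite /b; lra.
  have b0 : b != 0 by rewrite gt_eqF //; lra.
  set z := 2 * e * (1 / b - 1).
  have bz : b * z = 2 * e * (1 - b) by rewrite /z; field.
  have z0 : 0 <= z.
    by rewrite -(pmulr_rge0 z (x := b)) ?bz; [rewrite mulr_ge0 // /b; move: e_gt0; lra | lra].
  have z4 : z <= 1 / 4.
    have : 1 / 2 * z <= b * z by apply: ler_wpM2r.
    have : e * b >= e * (1 / 2) by apply: ler_wpM2l => //; exact: ltW.
    rewrite bz; move: e_le; lra.
  have zlt : z < 1 by lra.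
  apply: le_trans (ler_wpM2l (_ : 0 <= b) (expR_le_inv zlt)) _; first lra.
  rewrite ler_pdivrMr; last lra.
  have -> : 1 - (1 - 4 * e) * q / 2 = b + 4 * e * (1 - b) by rewrite /b; lra.
  have : 0 <= (e * (1 - b)) * (1 / 4 - z).
    by rewrite mulr_ge0 // ?mulr_ge0 ?(ltW e_gt0) //; rewrite /b; lra.
  move: bz; nra.
rewrite ler_wpM2l ?ler0n // add0n /phi /=.
apply: lerXn2r; rewrite ?nnegrE; [have := q01 #|P|; lra| |].
  have : expR (- 16) <= 1 :> R by rewrite expR_le1; lra.
  lra.
(* The 16 is 8 times 2: 1 - 4e >= exp(-8e) because e <= 1/8, and e times the size of [P] is at most
   2. *)
suff : expR (- 16) <= (1 - 4 * e) ^+ #|P| by lra.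
have H1 : expR (- (8 * e)) <= 1 - 4 * e.
  have h : - (8 * e) < 1 by move: e_gt0; lra.
  apply: le_trans (expR_le_inv h) _.
  rewrite invf_ple ?posrE; [|move: e_gt0; lra|move: e_gt0 e_le; lra].
  rewrite -div1r ler_pdivrMr; [|move: e_gt0 e_le; lra].
  have : 0 <= e * (1 / 8 - e) by rewrite mulr_ge0 ?(ltW e_gt0) // subr_ge0.
  lra.
apply: le_trans (_ : expR (- (8 * e)) ^+ #|P| <= _); last first.
  by apply: lerXn2r => //; rewrite nnegrE ?expR_ge0 //; case/andP: e1.
rewrite -expRM_natr ler_expR.
have : #|P|%:R <= 2 * #|D|%:R :> R by rewrite -natrM ler_nat.
move=> /(ler_wpM2r (ltW e_gt0)).
have -> : 2 * #|D|%:R * e = 2 by rewrite /e mulfK // pnatr_eq0; lia.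
lra.
Qed.

Lemma sum_hit_once_le (P : {set 'I_N}) :
    (8 * #|P| <= #|D|)%N -> (#|D| <= 16 * #|P|)%N ->
  \sum_(x : N.-tuple D) \prod_(j in I) (if hits P (A j) x == 1%N then 2^-1 else 1) <=
  #|{: N.-tuple D}|%:R * (127 / 128 : R) ^+ #|I|.
Proof.
move=> P8 P16.
have D0 : (0 < #|D|)%N by lia.
have eP (t : nat) : (8 * t <= #|D|)%N -> 0 <= t%:R * e <= 1 / 8.
  rewrite -(ler_nat R) natrM => /(ler_wpM2r (ltW e_gt0)).
  rewrite mulfV ?pnatr_eq0 -?lt0n // => h; rewrite mulr_ge0 ?(ltW e_gt0) //=; lra.
(* A class hit once gains weight with each further position, since another hit raises 1/2 to 1. A
   class not yet hit loses weight, since a hit takes it from about 1 to about 1/2. The true rates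
   are about 1/n each; 2/n and 1/(8n) leave slack. With te <= 1/8 the weight at 1 stays at most
   3/4. *)
pose phi (t c : nat) : R :=
  if c == 0%N then 1 - t%:R * e / 8 else if c == 1%N then 1 / 2 + 2 * (t%:R * e) else 1.
have := @sum_prod_hits_le R D N J I A phi 0%N P => /(_ D0 dA A2 _ _)/le_trans H.
have E x j : (if hits P (A j) x == 1%N then 2^-1 else 1) = phi 0%N (hits P (A j) x).
  rewrite /phi mul0r; case: (hits P (A j) x) => [|[|c]] //=; lra.
under eq_bigr => x _ do under eq_bigr => j _ do rewrite E.
apply: H.
- move=> t c; rewrite add0n => tP; have /eP h : (8 * t <= #|D|)%N by lia.
  by rewrite /phi; case: c => [|[|c]] //=; lra.
- move=> t c; rewrite add0n => tP; have /eP h : (8 * t <= #|D|)%N by lia.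
  have St : t.+1%:R * e = t%:R * e + e by rewrite -natr1; lra.
  rewrite /phi St; move: h; set q := t%:R * e => h; rewrite -/e.
  case: c => [|[|c]] /=; last by rewrite divr1 subrr mulr0 expR0 mulr1.
  + set a := 1 - q / 8; set b := 1 / 2 + 2 * q.
    have a0 : a != 0 by rewrite gt_eqF // /a; lra.
    set z := 2 * e * (b / a - 1).
    have az : a * z = 2 * e * (b - a) by rewrite /z; field.
    have z0 : z <= 0.
      rewrite -(pmulr_rle0 z (x := a)) ?az; last by rewrite /a; lra.
      by rewrite mulr_ge0_le0 // /a /b; move: e_gt0; lra.
    have zlt : z < 1 by lra.
    apply: le_trans (ler_wpM2l (_ : 0 <= a) (expR_le_inv zlt)) _; first by rewrite /a; lra.
    rewrite ler_pdivrMr; last lra.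
    have z1 : - z <= 1.
      have : a * (- z) <= a * 1.
        rewrite mulrN az; have : e * (a - b) <= 1 / 8 * (a - b).
          by apply: ler_wpM2r => //; rewrite /a /b; lra.
        rewrite /a /b; lra.
      by rewrite ler_pM2l // /a; lra.
    have -> : 1 - (q + e) / 8 = a - e / 8 by rewrite /a; lra.
    have : e * (- z) <= e * 1 by apply: ler_wpM2l => //; exact: ltW.
    have : e * (1 / 8) <= e * (a - b).
      by apply: ler_wpM2l; [exact: ltW | rewrite /a /b; lra].
    move: az; move: e_gt0; nra.
  + set b := 1 / 2 + 2 * q.
    have b0 : b != 0 by rewrite gt_eqF // /b; lra.
    set z := 2 * e * (1 / b - 1).
    have bz : b * z = 2 * e * (1 - b) by rewrite /z; field.
    have z0 : 0 <= z.
      rewrite -(pmulr_rge0 z (x := b)) ?bz; last by rewrite /b; lra.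
      by rewrite mulr_ge0 // /b; move: e_gt0; lra.
    have z4 : z <= 1 / 4.
      have : 1 / 2 * z <= b * z by apply: ler_wpM2r => //; rewrite /b; lra.
      have : e * b >= e * (1 / 2) by apply: ler_wpM2l; [exact: ltW | rewrite /b; lra].
      rewrite bz; move: e_le; lra.
    have zlt : z < 1 by lra.
    apply: le_trans (ler_wpM2l (_ : 0 <= b) (expR_le_inv zlt)) _; first by rewrite /b; lra.
    rewrite ler_pdivrMr; last lra.
    have -> : 1 / 2 + 2 * (q + e) = b + 2 * e by rewrite /b; lra.
    have : e * z <= e * (1 / 4) by apply: ler_wpM2l => //; exact: ltW.
    have : e * b >= e * (1 / 2) by apply: ler_wpM2l; [exact: ltW | rewrite /b; lra].
    move: bz e_gt0; nra.
(* [P] has at least n/16 positions, so the weight at 0 ends at or below 1 - 1/128. *)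
rewrite ler_wpM2l ?ler0n // add0n /phi /=; have := eP _ P8.
move: P16; rewrite -(ler_nat R) natrM => /(ler_wpM2r (ltW e_gt0)).
rewrite mulfV ?pnatr_eq0 -?lt0n // => h1 h2.
by apply: lerXn2r; rewrite ?nnegrE; lra.
Qed.

End PairOccupancy.

Lemma prod_if_exp (R : realType) (J : finType) (I : {set J}) (c : pred J) (a : R) :
  \prod_(j in I) (if c j then a else 1) = a ^+ #|[set j in I | c j]|.
Proof.
rewrite -big_mkcondr /= (eq_bigl (fun j => j \in [set j in I | c j])) ?prodr_const //.
by move=> j; rewrite inE.
Qed.

(** * Fresh and hard pairs of positions *)

Section Pairs.
Variables (D : finType) (N : nat) (J : finType) (l r : J -> 'I_N).
Hypotheses (lI : injective l) (rI : injective r) (lr : forall i j, l i != r j).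
Implicit Types (x y : N.-tuple D) (I : {set J}).

Definition pair_values x j : {set D} := [set tnth x (l j); tnth x (r j)].

(** The part of hardness that is visible at the positions of the pairs in [I] alone. It can be built
    up pair by pair, while the remaining positions are left to the occupancy bound. *)
Definition fresh I x : {set J} :=
  [set j in I | (tnth x (l j) != tnth x (r j)) &&
     [forall i in I, (i != j) ==> [disjoint pair_values x i & pair_values x j]]].

Definition hard x j :=
  (tnth x (l j) != tnth x (r j)) &&
  [forall p, (p != l j) ==> (p != r j) ==> (tnth x p \notin pair_values x j)].

Lemma freshP I x j : reflect
  [/\ j \in I, tnth x (l j) != tnth x (r j) &
    forall i, i \in I -> i != j -> [disjoint pair_values x i & pair_values x j]]
  (j \in fresh I x).
Proof.
rewrite inE; apply: (iffP andP) => [[jI /andP[? /forall_inP H]]|[jI ? H]]; split => //.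
  by move=> i iI ij; have := H i iI; rewrite ij.
by apply/andP; split => //; apply/forall_inP => i iI; apply/implyP; exact: H.
Qed.

Lemma fresh_disjoint I x :
  {in fresh I x &, forall i j, i != j -> [disjoint pair_values x i & pair_values x j]}.
Proof. by move=> i j /freshP[iI _ _] /freshP[_ _ H] ij; exact: H. Qed.

Lemma sub_fresh_update I x i d e : i \notin I ->
    d \notin \bigcup_(j in I) pair_values x j ->
    e \notin \bigcup_(j in I) pair_values x j -> d != e ->
  i |: fresh I x \subset fresh (i |: I) (update (update x (l i) d) (r i) e).
Proof.
move=> iI dV eV de; set x' := update _ _ _.
have xl j : tnth x' (l j) = if j == i then d else tnth x (l j).
  by rewrite !tnth_update (negbTE (lr _ _)) (inj_eq lI).
have xr j : tnth x' (r j) = if j == i then e else tnth x (r j).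
  by rewrite !tnth_update (inj_eq rI) eq_sym; case: eqP => // _; rewrite eq_sym (negbTE (lr _ _)).
have pE j : j != i -> pair_values x' j = pair_values x j.
  by move=> ji; rewrite /pair_values xl xr (negbTE ji).
have pi : pair_values x' i = [set d; e] by rewrite /pair_values xl xr eqxx.
have dis j : j \in I -> [disjoint pair_values x j & [set d; e]].
  move=> jI; rewrite disjoint_sym finset.disjoints_subset; apply/fintype.subsetP => a.
  rewrite in_set2 finset.in_setC => /orP[/eqP->|/eqP->].
    by apply: contra dV => h; apply/finset.bigcupP; exists j.
  by apply: contra eV => h; apply/finset.bigcupP; exists j.
apply/fintype.subsetP => j; rewrite in_setU1 => /orP[/eqP->|/freshP[jI nj H]].
  apply/freshP; split; rewrite ?setU11 ?xl ?xr ?eqxx // => k.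
  by rewrite in_setU1 => /orP[->//|kI] ki; rewrite pE // pi dis.
have ji : j != i by apply: contraNneq iI => <-.
apply/freshP; split; rewrite ?in_setU1 ?jI ?orbT ?xl ?xr ?(negbTE ji) // => k.
rewrite in_setU1 (pE j) // => /orP[/eqP->|kI] kj; first by rewrite pi disjoint_sym dis.
by rewrite pE ?H //; apply: contraNneq iI => <-.
Qed.

(** Fresh pairs have disjoint values, so each of the two new values meets at most one of them. *)
Lemma card_fresh_update I x i d e : i \notin I ->
  (#|fresh I x| <= #|fresh (i |: I) (update (update x (l i) d) (r i) e)| + 2)%N.
Proof.
move=> iI; set x' := update _ _ _.
have nei j : j \in I -> j != i by move=> jI; apply: contraNneq iI => <-.
have xl j : tnth x' (l j) = if j == i then d else tnth x (l j).
  by rewrite !tnth_update (negbTE (lr _ _)) (inj_eq lI).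
have xr j : tnth x' (r j) = if j == i then e else tnth x (r j).
  by rewrite !tnth_update (inj_eq rI) eq_sym; case: eqP => // _; rewrite eq_sym (negbTE (lr _ _)).
have pE j : j != i -> pair_values x' j = pair_values x j.
  by move=> ji; rewrite /pair_values xl xr (negbTE ji).
have pi : pair_values x' i = [set d; e] by rewrite /pair_values xl xr eqxx.
pose hit a := [set j in fresh I x | a \in pair_values x j].
have hitP a j : (j \in hit a) = (j \in fresh I x) && (a \in pair_values x j).
  by rewrite /hit finset.in_set.
have hit1 a : (#|hit a| <= 1)%N.
  apply/card_le1_eqP => j k; rewrite !hitP => /andP[jf aj] /andP[kf ak].
  apply/eqP/negPn/negP; rewrite eq_sym => jk.
  by have := disjointFr (fresh_disjoint jf kf jk) aj; rewrite ak.
have sub : fresh I x \subset fresh (i |: I) x' :|: (hit d :|: hit e).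
  apply/fintype.subsetP => j jf; have /freshP[jI nj H] := jf.
  rewrite 2!finset.in_setU !hitP jf /=; have ji := nei j jI.
  have [dj|dj] := boolP (d \in pair_values x j); first by rewrite orbT.
  have [ej|ej] := boolP (e \in pair_values x j); first by rewrite !orbT.
  rewrite !orbF.
  apply/freshP; split; rewrite ?in_setU1 ?jI ?orbT ?xl ?xr ?(negbTE ji) // => k.
  rewrite in_setU1 (pE j) // => /orP[/eqP->|kI] kj; last by rewrite pE ?H ?nei.
  rewrite pi finset.disjoints_subset; apply/fintype.subsetP => a.
  by rewrite in_set2 finset.in_setC => /orP[/eqP->|/eqP->].
apply: leq_trans (subset_leq_card sub) _.
apply: leq_trans (leq_card_setU _ _).1 _; rewrite leq_add2l.
by apply: leq_trans (leq_card_setU _ _).1 _; rewrite (leq_add (hit1 _) (hit1 _)).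
Qed.

Lemma card_bigcup_pair_values I x : (#|\bigcup_(j in I) pair_values x j| <= 2 * #|I|)%N.
Proof.
have h : (#|\bigcup_(j in I) pair_values x j| <= \sum_(j in I) #|pair_values x j|)%N.
  apply: (big_ind2 (fun (A : {set D}) m => #|A| <= m)%N); rewrite ?cards0 //.
  move=> A m B k Am Bk; apply: leq_trans (leq_card_setU _ _).1 _; exact: leq_add.
apply: leq_trans h _; rewrite mulnC -sum_nat_const; apply: leq_sum => j _.
by rewrite cards2; case: eqP.
Qed.

End Pairs.

(** * Most inputs have many hard pairs *)

Section HardPairs.
Variables (R : realType) (D : finType) (N : nat) (J : finType) (l r : J -> 'I_N).
Hypotheses (lI : injective l) (rI : injective r) (lr : forall i j, l i != r j).

(* Adding a pair creates a fresh one unless one of its two values was used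
   before or they coincide, and destroys at most two; b ^- 2 <= 4. *)
Lemma sum_fresh_le (b : R) (I : {set J}) : 1 / 2 <= b <= 1 -> (0 < #|D|)%N ->
  \sum_(x : N.-tuple D) b ^+ #|fresh l r I x| <=
  #|{: N.-tuple D}|%:R * (b + 4 * (4 * #|J| + 1)%:R / #|D|%:R) ^+ #|I|.
Proof.
move=> /andP[b2 b1] D0.
have D0R : (0 : R) < #|D|%:R by rewrite ltr0n.
have b0 : 0 <= b by lra.
set rho := b + _.
have rho0 : 0 <= rho by rewrite /rho addr_ge0 // divr_ge0 // mulr_ge0.
have [k kI] : exists k, k = #|I| by exists #|I|.
elim: k => [|k IH] in I kI *.
  have -> : I = finset.set0 by apply/eqP; rewrite -cards_eq0 -kI.
  under eq_bigr => x _.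
    have -> : fresh l r finset.set0 x = finset.set0 by apply/setP => j; rewrite !inE.
    over.
  by rewrite !cards0 !expr0 mulr1 sumr_const.
have [i iI] : exists i, i \in I by apply/card_gt0P; rewrite -kI.
rewrite -(finset.setD1K iI).
have iI' : i \notin I :\ i by rewrite !inE eqxx.
have kI' : k = #|I :\ i| by move: kI; rewrite (cardsD1 i) iI => -[].
have := IH _ kI'; set I' := I :\ i in iI' kI' *; move: I' iI' kI' => K {}iI {}kI {}IH.
rewrite cardsU1 iI add1n exprSr mulrA.
have IH' : (\sum_(x : N.-tuple D) b ^+ #|fresh l r K x|) * rho <=
   #|{: N.-tuple D}|%:R * rho ^+ #|K| * rho by apply: ler_wpM2r.
apply: le_trans IH'.
rewrite -(ler_pMn2r D0) -(ler_pMn2r D0) -(sum_update (r i)) -(sum_update (l i)).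
rewrite mulr_suml -!sumrMnl; apply: ler_sum => x _.
set V := \bigcup_(j in K) pair_values l r x j.
have cV : (#|V| <= 2 * #|J|)%N.
  by apply: leq_trans (card_bigcup_pair_values _ _ _ _) _; rewrite leq_mul2l max_card.
(* [u] counts the ways in which the new pair fails to be fresh. Its mean over [d] and [e] is (2|V| +
   1)/n, at most (4|J| + 1)/n. *)
pose u d e : R := (d \in V)%:R + (e \in V)%:R + (d == e)%:R.
apply: (@le_trans _ _ (\sum_d \sum_e (b ^+ #|fresh l r K x| * (b + 4 * u d e)))).
  apply: ler_sum => d _; apply: ler_sum => e _.
  set c := #|fresh l r K x|; set x' := update _ _ _.
  have c0 : 0 <= b ^+ c by apply: exprn_ge0.
  have [/and3P[dV eV de]|] := boolP [&& d \notin V, e \notin V & d != e].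
    have /subset_leq_card := sub_fresh_update lI rI lr iI dV eV de.
    rewrite cardsU1 (_ : i \notin fresh _ _ _ _) ?add1n; last first.
      by apply: contra iI => /freshP[].
    move=> h; apply: le_trans (ler_wiXn2l b0 b1 h) _.
    rewrite exprSr ler_wpM2l // lerDl mulr_ge0 // /u; rewrite !addr_ge0 //.
  move=> un; have u1 : 1 <= u d e.
    move: un; rewrite /u; case: (d \in V); case: (e \in V); case: (d == e) => //= _; lra.
  have h := card_fresh_update lI rI lr x d e iI.
  apply: (@le_trans _ _ (b ^+ c * 4)); last first.
    by apply: ler_wpM2l => //; lra.
  have h2 := ler_wiXn2l b0 b1 h; rewrite exprD in h2.
  have : b ^+ #|fresh l r (i |: K) x'| * (1 / 4) <= b ^+ #|fresh l r (i |: K) x'| * b ^+ 2.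
    by apply: ler_wpM2l; [exact: exprn_ge0 | rewrite expr2; nra].
  move: h2; rewrite -/x' -/c; lra.
under eq_bigr => d _ do rewrite -big_distrr /=.
rewrite -big_distrr /= -mulrnA -[leRHS]mulr_natr natrM -mulrA ler_wpM2l ?exprn_ge0 //.
have S1 : \sum_d (d \in V)%:R = #|V|%:R :> R.
  have E d : (d \in V)%:R = if d \in V then 1 else 0 :> R by case: (d \in V).
  by under eq_bigr => d _ do rewrite E; rewrite -big_mkcond sumr_const.
have S2 (d : D) : \sum_e (d == e)%:R = 1 :> R.
  rewrite (bigD1 d) //= eqxx big1 ?addr0 // => e; by rewrite eq_sym => /negbTE ->.
have -> : \sum_d \sum_e (b + 4 * u d e) =
    #|D|%:R * (#|D|%:R * b) + 4 * (#|D|%:R * #|V|%:R + #|D|%:R * #|V|%:R + #|D|%:R).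
  under eq_bigr => d _.
    rewrite big_split /= sumr_const -big_distrr /= /u !big_split /= S1 S2 sumr_const.
    over.
  rewrite big_split /= sumr_const -big_distrr /= !big_split /= !sumr_const.
  by rewrite sumrMnl S1; ring.
have -> : rho * (#|D|%:R * #|D|%:R) =
    #|D|%:R * (#|D|%:R * b) + 4 * (#|D|%:R * (4 * #|J| + 1)%:R).
  by rewrite /rho; field; rewrite gt_eqF.
rewrite lerD2l ler_wpM2l // natrD natrM.
have : #|V|%:R <= 2 * #|J|%:R :> R by rewrite -natrM ler_nat.
move=> /(ler_wpM2l (ltW D0R)); lra.
Qed.

(* Given the values at the pairs, a fresh pair is hard iff no other position
   hits it. *)
Lemma sum_hard_le : (8 <= #|D|)%N -> (N <= 2 * #|D|)%N ->
  \sum_(x : N.-tuple D) (2^-1 : R) ^+ #|[set j | hard l r x j]| <=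
  #|{: N.-tuple D}|%:R *
    (1 - expR (-16) / 2 + 4 * (4 * #|J| + 1)%:R / #|D|%:R) ^+ #|J|.
Proof.
move=> D8 N2; have D0 : (0 < #|D|)%N by lia.
have e16 : 0 <= expR (- 16 : R) <= 1 by rewrite expR_ge0 expR_le1; lra.
set b : R := 1 - _ / 2; have b1 : 1 / 2 <= b <= 1 by rewrite /b; lra.
have [X0|X0] := posnP #|{: N.-tuple D}|.
  by rewrite X0 mul0r big1 // => x; case: (fintype0 x X0).
(* Once the values on [Q] are fixed to those of [y], the set of fresh pairs is fixed, and the draws
   outside [Q] are the ones that may hit it. *)
pose Q := [set l j | j : J] :|: [set r j | j : J].
have lQ j : l j \in Q by rewrite finset.in_setU; apply/orP; left; apply: imset_f.
have rQ j : r j \in Q by rewrite finset.in_setU; apply/orP; right; apply: imset_f.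
rewrite -(ler_pMn2r X0) -(sum_overwrite Q).
apply: (@le_trans _ _ (\sum_y #|{: N.-tuple D}|%:R * b ^+ #|fresh l r [set: J] y|)); last first.
  rewrite -big_distrr /= -[leRHS]mulr_natl ler_wpM2l //.
  have := sum_fresh_le [set: J] b1 D0; rewrite cardsT => h; exact: h.
apply: ler_sum => y _.
have dis := @fresh_disjoint D N J l r [set: J] y.
have card2 : {in fresh l r [set: J] y, forall j, #|pair_values l r y j| = 2%N}.
  by move=> j /freshP[_ nj _]; rewrite cards2 nj.
have P2 : (#|~: Q| <= 2 * #|D|)%N.
  by apply: leq_trans N2; apply: leq_trans (max_card _) _; rewrite card_ord.
apply: le_trans (sum_not_hit_le R D8 dis card2 P2).
apply: ler_sum => x _; rewrite prod_if_exp; apply: ler_wiXn2l; rewrite ?invr_ge0 //; first lra.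
apply: subset_leq_card; apply/fintype.subsetP => j.
rewrite finset.in_set => /andP[/freshP[_ nj H] /eqP h0].
rewrite finset.in_set /hard /pair_values !tnth_overwrite lQ rQ nj /=.
apply/forallP => p; apply/implyP => pl; apply/implyP => pr.
(* A position in [Q] belongs to another pair, which freshness excludes; a position outside [Q] is
   excluded by the absence of hits. *)
rewrite tnth_overwrite; case: ifP => [/finset.setUP[]/imsetP[i _ pE]|/negbT pQ].
  - have ij : i != j by apply: contraNneq pl => <-; rewrite pE.
    by rewrite (disjointFr (H i (finset.in_setT i) ij)) // pE set21.
  - have ij : i != j by apply: contraNneq pr => <-; rewrite pE.
    by rewrite (disjointFr (H i (finset.in_setT i) ij)) // pE set22.
apply/negP => xp; move/eqP: h0; rewrite cards_eq0 => /eqP/setP/(_ p).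
by rewrite finset.in_set finset.in_setC pQ xp finset.in_set0.
Qed.

End HardPairs.

(** * Effect on the windows of exchanging two values *)

Section Windows.
Variables (D : finType) (V : eqType) (n : nat) (F : seq D -> V).
Hypothesis F_perm : forall a b, perm_eq a b -> F a = F b.
Hypothesis F_map : forall (s : D -> D) a, injective s -> F (map s a) = F a.
Hypothesis F_neq : forall u v (a : seq D), u != v -> u \notin a -> v \notin a ->
  F (v :: u :: a) != F (v :: v :: a).

Local Notation N := (2 * n - 1)%N.
Implicit Types (x y : N.-tuple D) (i : 'I_n) (p a b : 'I_N) (P : {set 'I_N}).

Definition window_positions i : seq 'I_N := take n (drop i (enum 'I_N)).

Lemma mem_window_positions i p : (p \in window_positions i) = (i <= p < i + n)%N.
Proof.
rewrite -(mem_map val_inj) map_take map_drop val_enum_ord drop_iota take_iota mem_iota.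
by have := ltn_ord i; rewrite add0n /=; move: (nat_of_ord i) (nat_of_ord p) => j q; lia.
Qed.

Lemma uniq_window_positions i : uniq (window_positions i).
Proof. by rewrite take_uniq // drop_uniq // enum_uniq. Qed.

Lemma sliding_windowE x i :
  sliding_window F x i = F [seq tnth x p | p <- window_positions i].
Proof. by rewrite /sliding_window map_take map_drop map_tnth_enum. Qed.

Section SwapPair.
Variables (P : {set 'I_N}) (y : N.-tuple D) (a b : 'I_N).
Hypotheses (aP : a \notin P) (bP : b \notin P).
Let u := tnth y a.
Let v := tnth y b.
Hypothesis uv : u != v.
Hypothesis fresh_uv : forall p, p \notin P -> p != a -> p != b ->
  tnth y p \notin [set u; v].

(** Used below [overwrite (~: P) y], which reads [x] only on [P]: the exchange takes effect there,
    while positions [a] and [b] keep [u] and [v]. *)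
Let swap x : N.-tuple D := map_tuple (tperm u v) x.

(** Exchanging u and v on [P] amounts to exchanging them everywhere and then exchanging the
    positions [a] and [b]. The window is stable under the latter, so it is renamed and permuted. *)
Lemma sliding_window_swap_other x i :
    (a \in window_positions i) = (b \in window_positions i) ->
  sliding_window F (overwrite (~: P) y (swap x)) i =
  sliding_window F (overwrite (~: P) y x) i.
Proof.
move=> ab; rewrite !sliding_windowE.
set X := overwrite _ y x; set X' := overwrite _ y _.
have XE p : tnth X' p = tperm u v (tnth X (tperm a b p)).
  rewrite !tnth_overwrite tnth_map.
  case: (tpermP a b p) => [->|->|/eqP pa /eqP pb]; rewrite !finset.in_setC ?aP ?bP /=.
  - by rewrite tpermR.
  - by rewrite tpermL.
  case: (boolP (p \in P)) => //= pP.
  have := fresh_uv pP pa pb; rewrite !inE negb_or => /andP[pu pv].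
  by rewrite tpermD // eq_sym.
rewrite (eq_map XE) (map_comp (tperm u v)) F_map; last exact: perm_inj.
apply: F_perm; rewrite (map_comp (tnth X)); apply: perm_map.
apply: uniq_perm; rewrite ?uniq_window_positions //.
  by rewrite map_inj_uniq ?uniq_window_positions //; exact: perm_inj.
move=> p; rewrite -[p in LHS](tpermK a b) (mem_map (@perm_inj _ _)).
by case: (tpermP a b p) => [->|->|].
Qed.

Lemma sliding_window_swap_self x i :
    a \notin window_positions i -> b \in window_positions i ->
    {subset P <= window_positions i} ->
    hits P [set u; v] x = 1%N ->
  sliding_window F (overwrite (~: P) y (swap x)) i !=
  sliding_window F (overwrite (~: P) y x) i.
Proof.
move=> aW bW PW /eqP/cards1P[p pE]; rewrite !sliding_windowE.
set X := overwrite _ y x; set X' := overwrite _ y _.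
have hitE q : q \in P -> (tnth x q \in [set u; v]) = (q == p).
  by move=> qP; have := finset.in_set1 q p; rewrite -pE finset.in_set qP.
have pP : p \in P by have := set11 p; rewrite -pE finset.in_set => /andP[].
have bp : b != p by apply: contraNneq bP => ->.
(* [p] is the only position of [P] that carries u or v. Up to order the window is [b], [p] and [c],
   where [c] avoids both values; position [b] holds v, and the exchange toggles [p] between u and
   v. *)
set W := window_positions i; pose c := rem p (rem b W).
have uW : uniq W by exact: uniq_window_positions.
have WE : perm_eq W [:: b, p & c].
  apply: perm_trans (perm_to_rem bW) _; rewrite perm_cons; apply: perm_to_rem.
  by rewrite mem_rem_uniq // inE eq_sym bp PW.
have cE q : q \in c -> [/\ q != a, q != b & q != p].
  rewrite mem_rem_uniq ?rem_uniq // inE mem_rem_uniq // inE => /and3P[-> -> qW].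
  by split=> //; apply: contraNneq aW => <-.
have XcE q : q \in c -> tnth X q \notin [set u; v].
  move=> /cE[qa qb qp]; rewrite tnth_overwrite finset.in_setC.
  by case: (boolP (q \in P)) => /= qP; [rewrite hitE | exact: fresh_uv].
have X'cE q : q \in c -> tnth X' q = tnth X q.
  move=> qc; have := XcE q qc; rewrite !tnth_overwrite tnth_map.
  case: ifP => // _; rewrite !inE negb_or => /andP[qu qv].
  by rewrite tpermD // eq_sym.
have Fc Y : F [seq tnth Y q | q <- W] =
    F [:: tnth Y b, tnth Y p & [seq tnth Y q | q <- c]].
  by apply: F_perm; have := perm_map (tnth Y) WE.
have nc w : w \in [set u; v] -> w \notin [seq tnth X q | q <- c].
  by move=> wuv; apply/mapP => -[q /XcE nq wq]; move: nq; rewrite -wq wuv.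
rewrite !Fc; have /eq_in_map -> := X'cE.
rewrite !tnth_overwrite !finset.in_setC bP pP /= tnth_map -/v.
have := hitE p pP; rewrite eqxx => /finset.set2P[->|->]; rewrite ?tpermL ?tpermR.
  by rewrite eq_sym; apply: F_neq; rewrite ?nc ?set21 ?set22.
by apply: F_neq; rewrite ?nc ?set21 ?set22.
Qed.

End SwapPair.
End Windows.

(** * Hard outputs with all but a few positions fixed *)

Section HardOutputs.
Variables (R : realType) (D : finType) (V : eqType) (n : nat) (F : seq D -> V).
Hypothesis F_perm : forall a b, perm_eq a b -> F a = F b.
Hypothesis F_map : forall (s : D -> D) a, injective s -> F (map s a) = F a.
Hypothesis F_neq : forall u v (a : seq D), u != v -> u \notin a -> v \notin a ->
  F (v :: u :: a) != F (v :: v :: a).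

Local Notation N := (2 * n - 1)%N.

Variables (J : finType) (l r : J -> 'I_N) (o : J -> 'I_n).
Hypothesis ro : forall j, r j = o j :> nat.
Hypothesis lo : forall j, (l j).+1 = o j.
Hypotheses (lI : injective l) (rI : injective r) (lr : forall i j, l i != r j).
Implicit Types (x y : N.-tuple D) (j : J) (P Q : {set 'I_N}) (O : seq ('I_n * V)).

Definition hard_correct m O x : bool :=
  all (fun q => q.2 == sliding_window F x q.1) O &&
  (m <= #|[set j | hard l r x j & o j \in unzip1 O]|)%N.

(** A window separates the adjacent positions [l j] and [r j] only if it starts at [r j] or ends at
    [l j]. The second would give r j = i + n, but [r j] is below n. *)
Let l_window i j : i != o j ->
  (l j \in window_positions i) = (r j \in window_positions i).
Proof.
rewrite -val_eqE !mem_window_positions /= => ij.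
by have := ltn_ord i; have := ltn_ord (o j); have := ro j; have := lo j; lia.
Qed.

Lemma sum_hard_correct_free_le m O P y :
    (8 <= #|D|)%N -> (8 * #|P| <= #|D|)%N -> (#|D| <= 16 * #|P|)%N ->
    (forall p, p \in P -> n <= p)%N ->
    (forall p j, p \in P -> p < o j + n)%N ->
  \sum_(x : N.-tuple D) (hard_correct m O (overwrite (~: P) y x))%:R <=
  #|{: N.-tuple D}|%:R * (127 / 128 : R) ^+ m.
Proof.
move=> D8 P8 P16 nP Pn.
have rP j : r j \notin P.
  by apply/negP => /nP; have := ltn_ord (o j); have := ro j; lia.
have lP j : l j \notin P.
  by apply/negP => /nP; have := ltn_ord (o j); have := lo j; lia.
(* The assigned outputs that look hard outside [P]. This set depends on [y] and [O] only, and
   contains every assigned hard output whatever the values on [P]. *)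
pose I := [set j | [&& o j \in unzip1 O, tnth y (l j) != tnth y (r j) &
  [forall p, (p \notin P) ==> (p != l j) ==> (p != r j) ==>
     (tnth y p \notin pair_values l r y j)]]].
have IP j : j \in I -> [/\ o j \in unzip1 O, tnth y (l j) != tnth y (r j) &
    forall p, p \notin P -> p != l j -> p != r j -> tnth y p \notin pair_values l r y j].
  rewrite finset.in_set => /and3P[? ? /forallP H]; split => // p pP pl pr.
  by have := H p; rewrite pP pl pr.
have hardI x j : hard l r (overwrite (~: P) y x) j -> o j \in unzip1 O -> j \in I.
  rewrite /hard /pair_values !tnth_overwrite !finset.in_setC lP rP => /andP[nj /forallP H] jO.
  rewrite finset.in_set jO nj; apply/forallP => p; apply/implyP => pP.
  by have := H p; rewrite tnth_overwrite finset.in_setC pP.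
have [Im|mI] := ltnP #|I| m.
  have h0 : 0 <= 127 / 128 :> R by lra.
  rewrite big1 ?mulr_ge0 ?exprn_ge0 //.
  move=> x _; rewrite /hard_correct [X in _ && X]leqNgt (leq_ltn_trans _ Im) ?andbF //.
  apply: subset_leq_card; apply/fintype.subsetP => j.
  by rewrite finset.in_set => /andP[hj jO]; apply: hardI hj jO.
(* [ok j] is the event that the assignments to output [o j] are right; [w j] is 1/2 when [P] meets
   the two values exactly once, so that the exchange [sw j] changes this output. *)
pose ok j x : R := (all (fun q => (q.1 == o j) ==>
  (q.2 == sliding_window F (overwrite (~: P) y x) (o j))) O)%:R.
pose w j x : R := if hits P (pair_values l r y j) x == 1%N then 2^-1 else 1.
pose sw j (x : N.-tuple D) : N.-tuple D := map_tuple (tperm (tnth y (l j)) (tnth y (r j))) x.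
have dis : {in I &, forall i j, i != j -> [disjoint pair_values l r y i & pair_values l r y j]}.
  move=> i j iI jI ij; rewrite finset.disjoints_subset; apply/fintype.subsetP => a.
  have [_ _ H] := IP j jI.
  rewrite in_set2 finset.in_setC => /orP[]/eqP->; apply: H; rewrite ?lP ?rP ?lr //.
  - by rewrite (inj_eq lI).
  - by rewrite eq_sym lr.
  - by rewrite (inj_eq rI).
have card2 : {in I, forall j, #|pair_values l r y j| = 2%N}.
  by move=> j /IP[_ nj _]; rewrite cards2 nj.
apply: (@le_trans _ _ (#|{: N.-tuple D}|%:R * (127 / 128 : R) ^+ #|I|)); last first.
  have h0 : 0 <= 127 / 128 :> R by lra.
  have h1 : 127 / 128 <= 1 :> R by lra.
  by rewrite ler_wpM2l //; exact: ler_wiXn2l h0 h1 _ _ mI.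
apply: le_trans (sum_hit_once_le R D8 dis card2 P8 P16).
apply: (@le_trans _ _ (\sum_x \prod_(j in I) ok j x)).
  apply: ler_sum => x _; rewrite /hard_correct.
  have [/allP OK|_] := boolP (all _ O); last by rewrite prodr_ge0 // /ok => j _.
  rewrite big1 ?lern1 ?leq_b1 // => j _; rewrite /ok.
  suff -> : all (fun q => (q.1 == o j) ==>
    (q.2 == sliding_window F (overwrite (~: P) y x) (o j))) O by [].
  by apply/allP => q qO; apply/implyP => /eqP <-; exact: OK.
apply: sum_prod_flip_le (sw) _ _ _ _ _ _.
- move=> j x x' /(congr1 val) /= h; apply: val_inj => /=.
  by apply: inj_map h; exact: perm_inj.
- by move=> j x; rewrite /ok.
- by move=> j x; rewrite /w; case: ifP => // _; rewrite invr_ge0.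
- move=> i j iI jI ij x; rewrite /ok; have [_ nj Hj] := IP j jI.
  rewrite (sliding_window_swap_other F_perm F_map (lP j) (rP j) Hj) //.
  apply: l_window; apply: contra ij => /eqP/(congr1 val) /= e.
  by apply/eqP/rI/val_inj; rewrite /= !ro.
- move=> i j iI jI x; rewrite /w; have -> // : hits P (pair_values l r y i) (sw j x) =
    hits P (pair_values l r y i) x.
  apply: eq_card => p; rewrite !inE -!in_set2 tnth_map; congr (_ && _).
  case: tpermP => [->|->|//].
  + have [<-|ij] := eqVneq i j; first by rewrite set21 set22.
    by rewrite !(disjointFl (dis i j iI jI ij)) ?set21 ?set22.
  + have [<-|ij] := eqVneq i j; first by rewrite set21 set22.
    by rewrite !(disjointFl (dis i j iI jI ij)) ?set21 ?set22.
- move=> j jI x; rewrite /w; have [jO nj Hj] := IP j jI.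
  case: ifP => [/eqP h1|_]; last first.
    have b1 (b : bool) : b%:R <= 1 :> R by rewrite lern1 leq_b1.
    by have := b1 (all (fun q => (q.1 == o j) ==>
      (q.2 == sliding_window F (overwrite (~: P) y x) (o j))) O);
      have := b1 (all (fun q => (q.1 == o j) ==>
      (q.2 == sliding_window F (overwrite (~: P) y (sw j x)) (o j))) O); rewrite /ok; lra.
  have ne : sliding_window F (overwrite (~: P) y (sw j x)) (o j) !=
            sliding_window F (overwrite (~: P) y x) (o j).
    apply: (sliding_window_swap_self F_perm F_neq (rP j) nj Hj) => //.
    + by rewrite mem_window_positions; have := lo j; lia.
    + by rewrite mem_window_positions; have := ro j; have := ltn_ord (o j); lia.
    + move=> p pP; rewrite mem_window_positions; have := nP p pP; have := Pn p j pP.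
      have := ltn_ord (o j); lia.
  (* [O] assigns a value to [o j] that is the same before and after the exchange, whereas the window
     value changes: at most one of the two inputs is served correctly. *)
  rewrite divff // /ok -natrD (_ : 1 = 1%:R) // ler_nat.
  case: (boolP (all _ O)) => // /allP A1; case: (boolP (all _ O)) => // /allP A2.
  case/mapP: jO => q qO e; have := A1 q qO; have := A2 q qO; rewrite -e eqxx /=.
  by move=> /eqP -> /eqP e'; rewrite e' eqxx in ne.
Qed.

End HardOutputs.

(** * Runs of a branching program and their stages *)

Section ProgramRuns.
Variables (D : finType) (N M : nat) (V : eqType) (B : branching_program D N M V).
Implicit Types (x y : N.-tuple D) (v : bp_node B) (Q : {set 'I_N}).

(** Sinks are made fixed points so that a run can be iterated past its end and cut into stages of
    equal length. *)
Definition bp_step x v : bp_node B :=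
  if bp_query v is Some i then bp_child v (tnth x i) else v.

Lemma iter_step_sink x v k : bp_sink v -> iter k (bp_step x) v = v.
Proof. by move=> /eqP sv; elim: k => //= k ->; rewrite /bp_step sv. Qed.

Lemma bp_run_sink x v k : bp_sink v -> bp_run k v x = [::].
Proof. by move=> /eqP sv; case: k => //= k; rewrite sv. Qed.

Lemma bp_run_add x v a b :
  bp_run (a + b) v x = bp_run a v x ++ bp_run b (iter a (bp_step x) v) x.
Proof.
elim: a v => // a IH v; rewrite addSn iterSr /= /bp_step.
case E: (bp_query v) => [i|]; first by rewrite IH catA.
by rewrite iter_step_sink ?bp_run_sink // /bp_sink E.
Qed.

Lemma bp_edge_step x v : ~~ bp_sink v -> bp_edge v (bp_step x v).
Proof.
rewrite /bp_sink /bp_edge /bp_rel /bp_step /= => nv; rewrite nv /=.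
by case: (bp_query v) nv => // i _; apply/existsP; exists (tnth x i).
Qed.

Lemma bp_path_step x v k :
    (forall i, (i < k)%N -> ~~ bp_sink (iter i (bp_step x) v)) ->
  path (@bp_edge _ _ _ _ B) v (traject (bp_step x) (bp_step x v) k).
Proof.
elim: k v => //= k IH v H; rewrite bp_edge_step /=; last exact: (H 0%N).
by apply: IH => i ik; have := H i.+1 ik; rewrite iterSr.
Qed.

(** If no sink came up within as many steps as there are nodes, some node would repeat, against
    acyclicity. The first sink reached ends a source-sink path, so its index is at most the time. *)
Lemma bp_reaches_sink x :
  exists2 k, (k <= bp_time B)%N & (k < #|bp_node B|)%N /\
    bp_sink (iter k (bp_step x) (bp_source B)).
Proof.
set s := bp_source B; set f := bp_step x.
have [k kn kS] : exists2 k, (k < #|bp_node B|)%N & bp_sink (iter k f s).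
  have [/existsP[k kS]|/existsPn H] := boolP [exists k : 'I_#|bp_node B|, bp_sink (iter k f s)].
    by exists k.
  have nS i : (i < #|bp_node B|)%N -> ~~ bp_sink (iter i f s).
    by move=> ik; have := H (Ordinal ik).
  have : ~~ injectiveb (fun i : 'I_#|bp_node B|.+1 => iter i f s).
    apply/negP => /injectiveP/leq_card; by rewrite card_ord ltnn.
  move=> /injectivePn[a [b ab fab]].
  wlog ltab : a b ab fab / (a < b)%N.
    move=> W; case: (ltngtP a b) => h; [exact: (W a b)|apply: (W b a) => //; by rewrite eq_sym|].
    by case/eqP: ab; apply: val_inj.
  have aS : (a < #|bp_node B|)%N by have := ltn_ord b; lia.
  have e := bp_edge_step x (nS a aS).
  case/negP: (bp_acyclic e); rewrite -/f [X in connect _ _ X]fab.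
  have -> : iter b f s = iter (b - a.+1) f (f (iter a f s)).
    by rewrite -iterS -iterD subnK.
  apply/connectP; exists (traject f (f (f (iter a f s))) (b - a.+1)).
    apply: (@bp_path_step x (f (iter a f s)) (b - a.+1)) => i ib; rewrite -/f -iterS -iterD; apply: nS.
    by have := ltn_ord b; lia.
  by rewrite last_traject.
have ex : exists k, bp_sink (iter k f s) by exists k.
case: (ex_minnP ex) => m mS mmin; have mk := mmin k kS.
have mn : (m < #|bp_node B|)%N by apply: leq_ltn_trans kn.
exists m => //; rewrite /bp_time.
apply: (@leq_bigmax_cond _ _ (fun t : 'I_#|bp_node B| => nat_of_ord t) (Ordinal mn)).
have sz : size (traject f (f s) m) == m by rewrite size_traject.
apply/existsP; exists (Tuple sz) => /=; rewrite last_traject mS andbT.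
apply: bp_path_step => i im; apply: contraL im => iS; rewrite -leqNgt; exact: mmin.
Qed.

Lemma bp_output_run x k : (bp_time B <= k)%N ->
  bp_output B x = bp_run k (bp_source B) x.
Proof.
move=> Tk; have [m mT [mn mS]] := bp_reaches_sink x.
rewrite /bp_output -(subnKC (ltnW mn)) -(subnKC (leq_trans mT Tk)) !bp_run_add.
by rewrite !(bp_run_sink _ _ mS).
Qed.

Lemma mem_bp_run_mul x v t q z : reflect
    (exists2 k, (k < t)%N & z \in bp_run q (iter (k * q) (bp_step x) v) x)
    (z \in bp_run (t * q) v x).
Proof.
apply: (iffP idP).
  elim: t v => // t IH v; rewrite mulSn bp_run_add mem_cat => /orP[zq|/IH[k kt zk]].
    by exists 0%N.
  by exists k.+1 => //; rewrite mulSn addnC iterD.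
elim: t v => [v [k]|t IH v [[|k] kt zk]] //; rewrite mulSn bp_run_add mem_cat.
  by rewrite zk.
by rewrite IH ?orbT //; exists k => //; rewrite -iterD addnC -mulSn.
Qed.

(** A stage started at a given node is a decision tree. [Q] holds the positions fixed so far and [O]
    the assignments made; each query fixes one more position, after which the edge taken no longer
    depends on [x]. At a leaf both are constants and [leaf] applies. *)
Lemma sum_bp_run_le (R : realType) (G : seq ('I_M * V) -> N.-tuple D -> R) K c :
    (forall Q O y, (#|Q| <= K)%N -> \sum_x G O (overwrite Q y x) <= c) ->
  forall q v Q O y, (#|Q| + q <= K)%N ->
  \sum_x G (O ++ bp_run q v (overwrite Q y x)) (overwrite Q y x) <= c.
Proof.
move=> leaf; elim=> [|q IH] v Q O y QK /=.
  by rewrite addn0 in QK; under eq_bigr => x _ do rewrite cats0; exact: leaf.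
case E: (bp_query v) => [i|]; last first.
  under eq_bigr => x _ do rewrite cats0; apply: leaf; lia.
apply: (@sum_overwrite_le D N R Q (i |: Q) y
  (fun x => G (O ++ (bp_emit v (tnth x i) ++ bp_run q (bp_child v (tnth x i)) x)) x)).
  exact: finset.subsetUr.
move=> z; have iz x : tnth (overwrite (i |: Q) z x) i = tnth z i.
  by rewrite tnth_overwrite setU11.
under eq_bigr => x _ do rewrite iz catA.
by apply: IH; apply: leq_trans QK; rewrite cardsU1; case: (i \in Q) => /=; lia.
Qed.

End ProgramRuns.

Lemma exists_subset_card (T : finType) (A : {set T}) k :
  (k <= #|A|)%N -> exists2 P : {set T}, P \subset A & #|P| = k.
Proof.
move=> kA; exists [set x in take k (enum A)].
  by apply/fintype.subsetP => x; rewrite finset.in_set => /mem_take; rewrite mem_enum.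
rewrite cardsE (card_uniqP _) ?take_uniq ?enum_uniq // size_take -cardE.
by case: ltnP => // ?; apply/eqP; rewrite eqn_leq kA andbT.
Qed.

(** * Counting the inputs on which the program is correct *)

Section CorrectInputs.
Variables (R : realType) (D : finType) (V : eqType) (n : nat) (F : seq D -> V).
Hypothesis F_perm : forall a b, perm_eq a b -> F a = F b.
Hypothesis F_map : forall (s : D -> D) a, injective s -> F (map s a) = F a.
Hypothesis F_neq : forall u v (a : seq D), u != v -> u \notin a -> v \notin a ->
  F (v :: u :: a) != F (v :: v :: a).

Local Notation N := (2 * n - 1)%N.

Variables (J : finType) (l r : J -> 'I_N) (o : J -> 'I_n).
Hypothesis ro : forall j, r j = o j :> nat.
Hypothesis lo : forall j, (l j).+1 = o j.
Hypotheses (lI : injective l) (rI : injective r) (lr : forall i j, l i != r j).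
Variables (reg : {set 'I_N}) (k q : nat).
Hypothesis D8 : (8 <= #|D|)%N.
Hypotheses (kD : (8 * k <= #|D|)%N) (Dk : (#|D| <= 16 * k)%N).
Hypothesis nreg : forall p, p \in reg -> (n <= p)%N.
Hypothesis regn : forall p j, p \in reg -> (p < o j + n)%N.
Hypothesis kq : (k + q <= #|reg|)%N.

Let X : R := #|{: N.-tuple D}|%:R.

(** At most [q] positions being fixed, [reg] still has [k] free ones. These form [P], and everything
    else is fixed as well. *)
Lemma sum_hard_correct_le m O (Q : {set 'I_N}) (y : N.-tuple D) : (#|Q| <= q)%N ->
  \sum_x (hard_correct F l r o m O (overwrite Q y x))%:R <= X * (127 / 128) ^+ m.
Proof.
move=> Qq; have kr : (k <= #|reg :\: Q|)%N.
  rewrite cardsD; have := subset_leq_card (finset.subsetIr reg Q); lia.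
have [P /fintype.subsetP Psub kP] := exists_subset_card kr.
have Preg p : p \in P -> p \in reg by move=> /Psub; rewrite finset.in_setD => /andP[].
apply: (@sum_overwrite_le D N R Q (~: P) y (fun x => (hard_correct F l r o m O x)%:R)).
  apply/fintype.subsetP => p pQ; rewrite finset.in_setC.
  by apply/negP => /Psub; rewrite finset.in_setD pQ.
move=> z; apply: sum_hard_correct_free_le => //; rewrite ?kP //.
  by move=> p /Preg /nreg.
by move=> p j /Preg pr; exact: regn.
Qed.

Lemma sum_hard_correct_run_le (B : branching_program D N n V) m (v : bp_node B) :
  \sum_x (hard_correct F l r o m (bp_run q v x) x)%:R <= X * (127 / 128) ^+ m.
Proof.
have /card_gt0P[d _] : (0 < #|D|)%N by lia.
have := @sum_bp_run_le D N n V B R (fun O x => (hard_correct F l r o m O x)%:R) q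
  (X * (127 / 128) ^+ m) (fun Q O y => @sum_hard_correct_le m O Q y) q v finset.set0 [::]
  (nseq_tuple N d).
rewrite cards0 add0n => /(_ (leqnn q)); apply: le_trans.
rewrite le_eqVlt; apply/orP; left; apply/eqP; apply: eq_bigr => x _.
have -> // : overwrite finset.set0 (nseq_tuple N d) x = x.
by apply: eq_from_tnth => p; rewrite tnth_overwrite finset.in_set0.
Qed.

(** The inequality is proved for each input and then summed. [W] is any set containing the starting
    nodes of all stages, so that a program with a single stage pays for its source only. *)
Lemma card_correct_le (B : branching_program D N n V) (W : {set bp_node B}) t m :
    (0 < t)%N -> (bp_time B <= t * q)%N ->
    (forall x s, (s < t)%N -> iter (s * q) (bp_step x) (bp_source B) \in W) ->
  #|[set x | bp_correct B (sliding_window F) x]|%:R <=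
  2 ^+ (t * m) * (\sum_(x : N.-tuple D) 2^-1 ^+ #|[set j | hard l r x j]|) +
  #|W|%:R * (X * (127 / 128) ^+ m).
Proof.
move=> t0 Tt inW.
have -> : #|W|%:R * (X * (127 / 128) ^+ m) = \sum_(v in W) X * (127 / 128) ^+ m.
  by rewrite sumr_const mulr_natl.
apply: le_trans (lerD (lexx _) (ler_sum _ (fun v _ => sum_hard_correct_run_le m v))).
rewrite exchange_big /= big_distrr /= -big_split /= -sum1_card natr_sum big_mkcond /=.
apply: ler_sum => x _; rewrite finset.in_set.
have S0 : 0 <= \sum_(v in W) (hard_correct F l r o m (bp_run q v x) x)%:R :> R.
  by apply: sumr_ge0.
have H0 : 0 <= 2 ^+ (t * m) * 2^-1 ^+ #|[set j | hard l r x j]| :> R.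
  by rewrite mulr_ge0 ?exprn_ge0 ?invr_ge0.
case: ifP => [/andP[/forallP oall /allP ocor]|_]; last by rewrite addr_ge0.
set H := [set j | hard l r x j] in H0 *.
have [Htm|tmH] := ltnP #|H| (t * m).
  (* Markov's inequality pointwise: with fewer than tm hard pairs the first term is at least 1. *)
  apply: ler_wpDr => //; rewrite exprVn ler_pdivlMr ?exprn_gt0 // mul1r.
  by apply: ler_weXn2l; [lra | exact: ltnW].
apply: ler_wpDl => //.
rewrite (bp_output_run x Tt) in oall ocor.
pose node s := iter (s * q) (bp_step x) (bp_source B).
pose Hs (s : 'I_t) := [set j | hard l r x j & o j \in unzip1 (bp_run q (node s) x)].
(* Pigeonhole: all of the at least tm hard outputs are assigned in one of the t stages. *)
have [s ms] : exists s, (m <= #|Hs s|)%N.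
  apply/existsP; apply: contraT => /existsPn no.
  suff : (#|H| < t * m)%N by rewrite ltnNge tmH.
  have sub : H \subset \bigcup_s Hs s.
    apply/fintype.subsetP => j jH; have /mem_bp_run_mul[s st zs] := oall (o j).
    apply/finset.bigcupP; exists (Ordinal st) => //; rewrite finset.in_set.
    by move: jH; rewrite finset.in_set => ->; apply/mapP; eexists; [exact: zs|].
  apply: leq_ltn_trans (subset_leq_card sub) _.
  have h : (#|\bigcup_s Hs s| <= \sum_s #|Hs s|)%N.
    apply: (big_ind2 (fun (A : {set J}) a => #|A| <= a)%N); rewrite ?cards0 //.
    by move=> A a C c Aa Cc; apply: leq_trans (leq_card_setU _ _).1 _; exact: leq_add.
  apply: leq_ltn_trans h _.
  have m0 : (0 < m)%N by have := no (Ordinal t0); rewrite -ltnNge; lia.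
  apply: (@leq_ltn_trans (t * m.-1)); last by rewrite ltn_pmul2l // prednK.
  rewrite -[t in leqRHS]card_ord -sum_nat_const; apply: leq_sum => s _.
  by have := no s; rewrite -ltnNge; lia.
have sW : node s \in W by apply: inW.
rewrite (bigD1 (node s)) //=; apply: ler_wpDr; first by apply: sumr_ge0.
rewrite /hard_correct -/(Hs s) ms andbT.
have -> // : all (fun z => z.2 == sliding_window F x z.1) (bp_run q (node s) x).
by apply/allP => z zs; apply: ocor; apply/mem_bp_run_mul; exists s.
Qed.

End CorrectInputs.

(** * Frequency moments satisfy the three properties of F *)

Section FrequencyMoments.
Variables (k : nat) (D : eqType).
Implicit Types (a b : seq D) (u v : D).

Lemma freq_moment_perm a b : perm_eq a b -> freq_moment k a = freq_moment k b.
Proof.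
move=> ab; rewrite /freq_moment (perm_big (undup b)) /=; last first.
  by apply: perm_undup; exact: perm_mem.
by apply: eq_bigr => d _; rewrite (seq.permP ab).
Qed.

Lemma freq_moment_map (s : D -> D) a : injective s ->
  freq_moment k (map s a) = freq_moment k a.
Proof.
move=> sI; rewrite /freq_moment undup_map_inj // big_map; apply: eq_bigr => d _.
by rewrite count_map; congr (_ ^ _)%N; apply: eq_count => e /=; rewrite inj_eq.
Qed.

(** Together with the next lemma this compares 2 with 2 ^ k, which differ unless k = 1. For k = 0
    they differ by one, so the parity of the moment changes too. *)
Lemma freq_moment_cons_distinct u v a : u != v -> u \notin a -> v \notin a ->
  freq_moment k [:: v, u & a] = (2 + freq_moment k a)%N.
Proof.
move=> uv ua va; rewrite /freq_moment /= inE eq_sym (negbTE uv) (negbTE va) (negbTE ua) /=.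
rewrite !big_cons /= !eqxx (negbTE uv) eq_sym (negbTE uv).
rewrite (count_memPn va) (count_memPn ua) !addn0 !exp1n addnA; congr (_ + _)%N.
rewrite big_seq [in RHS]big_seq; apply: eq_bigr => d; rewrite mem_undup => da.
have /negbTE -> : v != d by apply: contraNneq va => ->.
by have /negbTE -> : u != d by apply: contraNneq ua => ->.
Qed.

Lemma freq_moment_cons_double v a : v \notin a ->
  freq_moment k [:: v, v & a] = (2 ^ k + freq_moment k a)%N.
Proof.
move=> va; rewrite /freq_moment /= inE eqxx (negbTE va) /=.
rewrite !big_cons /= !eqxx (count_memPn va) addn0; congr (_ + _)%N.
rewrite big_seq [in RHS]big_seq; apply: eq_bigr => d; rewrite mem_undup => da.
by have /negbTE -> : v != d by apply: contraNneq va => ->.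
Qed.

End FrequencyMoments.

(** * The concrete pairs and the resulting error bound *)

Section ErrorBound.
Variables (R : realType) (n : nat) (F : seq 'I_n -> nat).
Hypothesis F_perm : forall a b, perm_eq a b -> F a = F b.
Hypothesis F_map : forall (s : 'I_n -> 'I_n) a, injective s -> F (map s a) = F a.
Hypothesis F_neq : forall u v (a : seq 'I_n), u != v -> u \notin a -> v \notin a ->
  F (v :: u :: a) != F (v :: v :: a).
Variable B : branching_program 'I_n (2 * n - 1) n nat.

Lemma error_ge (M t m : nat) (W : {set bp_node B}) : (8 <= n)%N ->
    (uphalf n + 2 * M <= n)%N -> (0 < t)%N -> (bp_time B <= t * (n %/ 8))%N ->
    (forall x s, (s < t)%N -> iter (s * (n %/ 8)) (bp_step x) (bp_source B) \in W) ->
  1 - bp_error B R (sliding_window F) <=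
  2 ^+ (t * m) * (1 - expR (-16) / 2 + 4 * (4 * M + 1)%:R / n%:R) ^+ M +
  #|W|%:R * (127 / 128) ^+ m.
Proof.
move=> n8 hM t0 Tt inW.
(* The pairs are consecutive blocks of two from [h] on, and the region is [n, n + h). A window that
   starts at [h] or later, and below n, contains the whole region, which has room for n/8 queried
   and n/8 free positions. *)
pose h := uphalf n.
have h2 : (n <= 2 * h <= n.+1)%N by rewrite /h uphalf_half -{1 4}(odd_double_half n); lia.
have ol (j : 'I_M) : (h + 2 * j + 1 < n)%N by have := ltn_ord j; rewrite /h; lia.
have rl (j : 'I_M) : (h + 2 * j + 1 < 2 * n - 1)%N by have := ol j; lia.
have ll (j : 'I_M) : (h + 2 * j < 2 * n - 1)%N by have := ol j; lia.
pose l j := Ordinal (ll j); pose r j := Ordinal (rl j); pose o j := Ordinal (ol j).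
have ro j : r j = o j :> nat by [].
have lo j : (l j).+1 = o j by rewrite /= addn1.
have lI : injective l by move=> i j /(congr1 val) /= e; apply: val_inj => /=; lia.
have rI : injective r by move=> i j /(congr1 val) /= e; apply: val_inj => /=; lia.
have lr i j : l i != r j by rewrite -val_eqE /=; apply/eqP; lia.
pose reg := [set p : 'I_(2 * n - 1) | (n <= p < n + h)%N].
have regP p : p \in reg -> (n <= p < n + h)%N by rewrite finset.in_set.
have kq : (n %/ 8 + n %/ 8 <= #|reg|)%N.
  have el (i : 'I_h) : (n + i < 2 * n - 1)%N by have := ltn_ord i; lia.
  pose e (i : 'I_h) : 'I_(2 * n - 1) := Ordinal (el i).
  have eI : injective e by move=> i j /(congr1 val) /= e'; apply: val_inj => /=; lia.
  apply: (@leq_trans #|[set e i | i : 'I_h]|).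
    by rewrite card_imset // card_ord; lia.
  apply: subset_leq_card; apply/fintype.subsetP => p /imsetP[i _ ->].
  by rewrite finset.in_set /=; have := ltn_ord i; lia.
have nreg p : p \in reg -> (n <= p)%N by move=> /regP; lia.
have regn p j : p \in reg -> (p < o j + n)%N by move=> /regP /=; lia.
have n8' : (8 <= #|'I_n|)%N by rewrite card_ord.
have kD : (8 * (n %/ 8) <= #|'I_n|)%N by rewrite card_ord; lia.
have Dk : (#|'I_n| <= 16 * (n %/ 8))%N by rewrite card_ord; lia.
have N2 : (2 * n - 1 <= 2 * #|'I_n|)%N by rewrite card_ord; lia.
have cor := card_correct_le R F_perm F_map F_neq ro lo lI rI lr n8' kD Dk nreg regn kq m t0 Tt inW.
have := sum_hard_le R lI rI lr n8' N2; rewrite !card_ord => hd.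
have X0 : 0 < #|{: (2 * n - 1).-tuple 'I_n}|%:R :> R.
  by rewrite ltr0n card_tuple expn_gt0 card_ord (leq_trans _ n8).
have -> : 1 - bp_error B R (sliding_window F) =
    #|[set x | bp_correct B (sliding_window F) x]|%:R / #|{: (2 * n - 1).-tuple 'I_n}|%:R.
  rewrite /bp_error.
  have -> : [set x | ~~ bp_correct B (sliding_window F) x] =
      ~: [set x | bp_correct B (sliding_window F) x].
    by apply/setP => x; rewrite !inE.
  rewrite -(cardsC [set x | bp_correct B (sliding_window F) x]) natrD in X0 *.
  by field; rewrite gt_eqF.
rewrite ler_pdivrMr //; apply: le_trans cor _.
rewrite [leRHS]mulrDl; apply: lerD; rewrite -[leRHS]mulrA ler_wpM2l ?exprn_ge0 //.
- by rewrite mulrC.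
- by rewrite [leRHS]mulrC.
Qed.

End ErrorBound.

Lemma bp_time_lt (D : finType) (N M : nat) (V : eqType) (B : branching_program D N M V) :
  (bp_time B < #|bp_node B|)%N.
Proof.
have B0 : (0 < #|bp_node B|)%N by apply/card_gt0P; exists (bp_source B).
by rewrite -[X in (_ < X)%N](prednK B0) ltnS; apply/bigmax_leqP => t _; rewrite -ltnS prednK.
Qed.

(** * Choice of the constants *)

Section Constants.
Variable R : realType.

Lemma ln2_bounds : 1 / 2 <= ln (2 : R) <= 1.
Proof.
apply/andP; split; last by apply: (@le_ln1Dx R 1); lra.
have h : 1 / 2 < 1 :> R by lra.
rewrite -ler_expR lnK ?posrE //; apply: le_trans (expR_le_inv h) _.
by rewrite (_ : 1 - 1 / 2 = 2^-1) ?invrK //; lra.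
Qed.

(** With M about n/E pairs and E large, the collision term takes at most half of [kap], so rho is at
    most exp(-kap/2). As M >= n/(2E), the rate obtained is kap n/(4E), at least 2n/G by the choice
    of G. *)
Lemma hard_pairs_rate : exists2 G : nat, (8 <= G)%N & forall n : nat, (G <= n)%N ->
  exists2 M : nat, (uphalf n + 2 * M <= n)%N &
    let rho : R := 1 - expR (-16) / 2 + 4 * (4 * M + 1)%:R / n%:R in
    0 <= rho /\ rho ^+ M <= expR (- (2 * n%:R / G%:R)).
Proof.
pose kap : R := expR (- 16) / 2.
have kap0 : 0 < kap by rewrite divr_gt0 ?expR_gt0.
have kap2 : kap <= 1 / 2.
  have : expR (- 16) <= 1 :> R by rewrite expR_le1; lra.
  by rewrite /kap; lra.
have [E hE] : exists E : nat, 64 <= kap * E%:R.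
  exists (Num.bound (64 / kap)).
  by rewrite -ler_pdivrMl // mulrC ltW // archi_boundP // divr_ge0 // ltW.
have [G hG] : exists G : nat, 8 * E%:R <= kap * G%:R.
  exists (Num.bound (8 * E%:R / kap)).
  by rewrite -ler_pdivrMl // mulrC ltW // archi_boundP // divr_ge0 ?mulr_ge0 // ltW.
have E8 : (8 <= E)%N.
  rewrite -(ler_nat R); have : kap * E%:R <= 1 / 2 * E%:R by apply: ler_wpM2r.
  lra.
have GE : (E <= G)%N.
  rewrite -(ler_nat R); have : kap * G%:R <= 1 / 2 * G%:R by apply: ler_wpM2r.
  have : 0 <= E%:R :> R by [].
  lra.
have G0 : 0 < G%:R :> R by rewrite ltr0n; lia.
exists G => [|n Gn]; first by apply: leq_trans GE.
have n0 : 0 < n%:R :> R by rewrite ltr0n; lia.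
pose M := (n %/ E)%N.
have ME : (M * E <= n)%N by rewrite leq_trunc_div.
have M1' : (0 < M)%N by rewrite divn_gt0; lia.
have nM : (n <= 2 * M * E)%N.
  have := ltn_ceil n (_ : 0 < E)%N; rewrite -/M => /(_ ltac:(lia)); nia.
exists M.
  have h2 : (2 * uphalf n <= n.+1)%N by rewrite uphalf_half -{3}(odd_double_half n); lia.
  nia.
set rho : R := 1 - expR (-16) / 2 + 4 * (4 * M + 1)%:R / n%:R.
have rho0 : 0 <= rho.
  by rewrite /rho -/kap addr_ge0 ?divr_ge0 ?mulr_ge0 //; lra.
have M1 : 1 <= M%:R :> R by rewrite ler1n.
have rho1 : rho <= expR (- (kap / 2)).
  apply: le_trans (expR_ge1Dx _); rewrite /rho -/kap.
  suff : 4 * (4 * M + 1)%:R / n%:R <= kap / 2 by lra.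
  rewrite ler_pdivrMr // natrD natrM.
  have h1 : kap * (M * E)%:R <= kap * n%:R by rewrite ler_pM2l // ler_nat.
  have h2 : 64 * M%:R <= kap * E%:R * M%:R by apply: ler_wpM2r.
  rewrite natrM in h1; lra.
split => //; apply: (@le_trans _ _ (expR (- (kap / 2)) ^+ M)).
  by apply: lerXn2r => //; rewrite nnegrE ?expR_ge0.
rewrite -expRM_natr ler_expR mulNr lerN2 ler_pdivrMr //.
have h1 : n%:R <= 2 * M%:R * E%:R :> R by rewrite -!natrM ler_nat.
have h2 : 8 * E%:R * M%:R <= kap * G%:R * M%:R by apply: ler_wpM2r.
lra.
Qed.

Lemma expR1_ge2 : 2 <= expR 1 :> R.
Proof. by apply: le_trans (expR_ge1Dx _); lra. Qed.

(** As tmG <= n, the factor 2 ^ (tm) is at most exp(n/G), which uses up half of the exponent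
    2n/G. *)
Lemma error_ge_expR : exists2 G : nat, (8 <= G)%N &
  forall (n : nat) (F : seq 'I_n -> nat) (B : branching_program 'I_n (2 * n - 1) n nat)
      (t m : nat) (W : {set bp_node B}),
    (forall a b, perm_eq a b -> F a = F b) ->
    (forall (s : 'I_n -> 'I_n) a, injective s -> F (map s a) = F a) ->
    (forall u v (a : seq 'I_n), u != v -> u \notin a -> v \notin a ->
      F (v :: u :: a) != F (v :: v :: a)) ->
    (G <= n)%N -> (0 < t)%N -> (bp_time B <= t * (n %/ 8))%N -> (t * m * G <= n)%N ->
    (forall x i, (i < t)%N -> iter (i * (n %/ 8)) (bp_step x) (bp_source B) \in W) ->
  1 - bp_error B R (sliding_window F) <=
  expR (- (n%:R / G%:R)) + #|W|%:R * expR (- (m%:R / 128)).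
Proof.
have [G G8 H] := hard_pairs_rate; exists G => // n F B t m W Fp Fm Fn Gn t0 Tt tmG inW.
have [M hM [rho0 rhoM]] := H n Gn.
have n8 : (8 <= n)%N by apply: leq_trans Gn.
have G0 : 0 < G%:R :> R by rewrite ltr0n; lia.
apply: le_trans (error_ge R Fp Fm Fn m n8 hM t0 Tt inW) _; apply: lerD.
- have -> : - (n%:R / G%:R) = n%:R / G%:R + - (2 * n%:R / G%:R) :> R by field; rewrite gt_eqF.
  rewrite expRD; apply: ler_pM => //; rewrite ?exprn_ge0 //.
  apply: (@le_trans _ _ (expR 1 ^+ (t * m))).
    by apply: lerXn2r; rewrite ?nnegrE ?expR_ge0 //; exact: expR1_ge2.
  by rewrite -expRM_natr ler_expR mul1r ler_pdivlMr // -natrM ler_nat.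
- apply: ler_wpM2l => //.
  apply: (@le_trans _ _ (expR (- (1 / 128)) ^+ m)).
    have h0 : 0 <= 127 / 128 :> R by lra.
    apply: lerXn2r; rewrite ?nnegrE ?expR_ge0 //.
    by apply: le_trans (expR_ge1Dx _); lra.
  by rewrite -expRM_natr ler_expR; lra.
Qed.

(** Since e >= 2, a sum of two exponentials costs one unit in the exponent. *)
Lemma double_expR_le (a b c : R) : a + 1 <= c -> b + 1 <= c ->
  expR a + expR b <= expR c.
Proof.
move=> ac bc; have e0 : 0 < expR (c - 1) by exact: expR_gt0.
have : expR a <= expR (c - 1) by rewrite ler_expR; lra.
have : expR b <= expR (c - 1) by rewrite ler_expR; lra.
have : 2 * expR (c - 1) <= expR c.
  rewrite (_ : expR c = expR 1 * expR (c - 1)); last by rewrite -expRD; congr expR; lra.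
  by apply: ler_wpM2r; [exact: ltW | exact: expR1_ge2].
lra.
Qed.

Lemma delta_numerics (G n delta : R) :
    1 <= G -> 512 * G <= n -> delta * (512 * G) = 1 ->
  [/\ 0 < delta, n / G = 512 * (delta * n) & 1 <= delta * n].
Proof.
move=> G1 Gn deltaG; have g0 : 0 < 512 * G by lra.
have delta0 : 0 < delta by rewrite -(pmulr_lgt0 _ g0) deltaG.
have G0 : 0 < G by lra.
split=> //; last first.
  have : delta * (512 * G) <= delta * n by rewrite ler_pM2l.
  by rewrite deltaG.
apply: (mulIf (lt0r_neq0 G0)); rewrite divfK ?lt0r_neq0 //.
have -> : 512 * (delta * n) * G = delta * (512 * G) * n by ring.
by rewrite deltaG mul1r.
Qed.

(** The case of a single stage: the only starting node is the source, so no union bound is paid and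
    the result is measured against n. *)
Lemma short_program_numerics (G n delta m : R) :
    1 <= G -> 512 * G <= n -> delta * (512 * G) = 1 -> n <= 2 * m * G ->
  expR (- (n / G)) + expR (- (m / 128)) <= expR (- (delta * n)).
Proof.
move=> G1 Gn deltaG nm; have [delta0 nG n1] := delta_numerics G1 Gn deltaG.
have : n / G <= 2 * m by rewrite ler_pdivrMr //; lra.
by rewrite nG => h; apply: double_expR_le; lra.
Qed.

(** The term exp(s) is the union bound over all nodes. If T s < c n ^ 2, then m + 1 >= 1280 s, so a
    stage's exp(-m/128) outweighs exp(s) with about 9 s to spare. *)
Lemma long_program_numerics (G n delta T q t m s c : R) :
    1 <= G -> 512 * G <= n -> delta * (512 * G) = 1 ->
    c * (64 * (640 * G)) = 1 -> 0 < T -> 0 <= m -> 1 / 2 <= s -> n <= 16 * q -> q <= T ->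
    t * q <= 2 * T -> n <= (m + 1) * (G * t) -> T * s < c * n ^+ 2 ->
  expR (- (n / G)) + expR (s + - (m / 128)) <= expR (- (delta * s)).
Proof.
move=> G1 Gn deltaG cG T0 m0 s2 nq qT tq nm TS.
have [delta0 nG n1] := delta_numerics G1 Gn deltaG.
have G0 : 0 < G by lra.
have n0 : 0 < n by lra.
have g0 : 0 < 64 * (640 * G) by lra.
have c0 : 0 < c by rewrite -(pmulr_lgt0 _ g0) cG.
have c16 : 16 * c <= 1.
  have : c * 1 <= c * G by rewrite ler_pM2l.
  lra.
(* Needed to compare exp(-n/G) with exp(-delta s); it follows from T >= n/16 and 16 c <= 1. *)
have sn : s <= n.
  have h1 : q * s <= T * s by apply: ler_wpM2r => //; lra.
  have h2 : n * s <= 16 * q * s by apply: ler_wpM2r => //; lra.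
  have h3 : 16 * c * n ^+ 2 <= 1 * n ^+ 2 by apply: ler_wpM2r => //; rewrite exprn_ge0 // ltW.
  rewrite -(ler_pM2l n0); rewrite expr2 in TS h3; lra.
(* From n <= 16q and tq <= 2T one gets n ^ 2 <= 32 (m + 1) G T, while the choice of c gives 64 * 640
   * G T s <= n ^ 2; and 64 * 640 / 32 = 1280. *)
have ms : 1280 * s <= m + 1.
  have h2 : n * q <= (m + 1) * G * (2 * T).
    have q0 : 0 <= q by lra.
    have h : n * q <= (m + 1) * (G * t) * q by apply: ler_wpM2r.
    have h' : (m + 1) * G * (t * q) <= (m + 1) * G * (2 * T).
      by apply: ler_wpM2l => //; rewrite mulr_ge0 // ?addr_ge0 // ltW.
    lra.
  have h3 : n * n <= n * (16 * q) by rewrite ler_pM2l.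
  have h4 : T * s * (64 * (640 * G)) <= n * n.
    have h : T * s * (64 * (640 * G)) <= c * n ^+ 2 * (64 * (640 * G)).
      by apply: ler_wpM2r; [lra | exact: ltW].
    by apply: le_trans h _; rewrite mulrAC cG mul1r expr2.
  have TG : 0 < T * G by rewrite mulr_gt0.
  rewrite -(ler_pM2l TG); lra.
have d1 : delta * s <= 1 * s.
  apply: ler_wpM2r; first lra.
  have : delta * 1 <= delta * G by rewrite ler_pM2l.
  lra.
have dw : delta * s <= delta * n by rewrite ler_pM2l.
by rewrite nG; apply: double_expR_le; lra.
Qed.

End Constants.

Lemma leq_double_divn n d : (0 < d <= n)%N -> (n <= 2 * (n %/ d) * d)%N.
Proof.
case/andP=> d0 dn; have q1 : (0 < n %/ d)%N by rewrite divn_gt0.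
have := ltn_ceil n d0; nia.
Qed.

Lemma ceil_mul_bounds T q : (0 < q <= T)%N ->
  (T <= (T %/ q).+1 * q <= 2 * T)%N.
Proof.
case/andP=> q0 qT; apply/andP; split; first exact/ltnW/ltn_ceil.
by rewrite mulSn; have := leq_trunc_div T q; lia.
Qed.

Lemma mul_divn_mul_le n G t : (t * (n %/ (G * t)) * G <= n)%N.
Proof. by rewrite mulnAC mulnC (mulnC t); exact: leq_trunc_div. Qed.

Lemma pos_inverse (R : realType) (a : R) : 0 < a -> exists2 d : R, 0 < d & d * a = 1.
Proof. by move=> a0; exists a^-1; rewrite ?invr_gt0 // mulVf // gt_eqF. Qed.

Lemma program_numerics (R : realType) (G : nat) : (0 < G)%N ->
  exists delta c : R, exists n0 : nat, [/\ 0 < delta, 0 < c & forall n : nat, (n0 <= n)%N ->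
  [/\ (G <= n)%N,
    forall m : R, n%:R <= 2 * m * G%:R ->
      expR (- (n%:R / G%:R)) + expR (- (m / 128)) <= expR (- (delta * n%:R)) &
    forall T q t m s : R, 0 < T -> 0 <= m -> 1 / 2 <= s ->
      n%:R <= 16 * q -> q <= T -> t * q <= 2 * T ->
      n%:R <= (m + 1) * (G%:R * t) -> T * s < c * n%:R ^+ 2 ->
      expR (- (n%:R / G%:R)) + expR (s + - (m / 128)) <= expR (- (delta * s))]].
Proof.
move=> G0; have G1 : 1 <= G%:R :> R by rewrite ler1n.
have g0 : (0 : R) < 512 * G%:R by lra.
have g'0 : (0 : R) < 64 * (640 * G%:R) by lra.
have [delta delta0 deltaG] := pos_inverse g0; have [c c0 cG] := pos_inverse g'0.
exists delta, c, (Num.bound (512 * G%:R : R)); split => // n hn.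
have gn : 512 * G%:R <= n%:R :> R.
  by apply: ltW; apply: (lt_le_trans (archi_boundP (ltW g0))); rewrite ler_nat.
split; first by rewrite -(ler_nat R); lra.
  by move=> m; exact: short_program_numerics.
by move=> T q t m s; exact: long_program_numerics.
Qed.

(** * The time-space lower bound *)

Lemma sliding_TS_lower_bound_uniform (R : realType) :
  exists2 delta : R, 0 < delta &
  forall F : (forall n : nat, seq 'I_n -> nat),
    (forall n a b, perm_eq a b -> F n a = F n b) ->
    (forall n (s : 'I_n -> 'I_n) a, injective s -> F n (map s a) = F n a) ->
    (forall n u v (a : seq 'I_n), u != v -> u \notin a -> v \notin a ->
      F n (v :: u :: a) != F n (v :: v :: a)) ->
  sliding_TS_lower_bound F delta.
Proof.
have [G G8 bound] := error_ge_expR R.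
have G0 : (0 < G)%N by exact: leq_trans G8.
have [delta [c [n1 [delta0 c0 num]]]] := program_numerics R G0.
exists delta => // F Fp Fm Fn; exists c; split => //; exists n1 => n hn B eta eta0 etaS etan err.
have {num hn}[Gn short long] := num n hn.
have n0 : 0 < n%:R :> R by rewrite ltr0n (leq_trans G0).
rewrite leNgt; apply/negP => TS.
(* The space in natural units: s = S ln 2, which is at most S and turns 2 ^ (-delta S) into
   exp(-delta s). *)
set s : R := ln #|bp_node B|%:R.
have B0 : (0 < #|bp_node B|)%N by apply/card_gt0P; exists (bp_source B).
have sE : expR s = #|bp_node B|%:R by rewrite lnK // posrE ltr0n.
have s0 : 0 <= s by rewrite ln_ge0 // ler1n.
have /andP[ln2l ln2u] := ln2_bounds R.
have ln20 : 0 < ln 2 :> R by lra.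
have pow2 (z : R) : 2 `^ z = expR (z * ln 2) by rewrite /powR pnatr_eq0.
have etaS' : expR (- (delta * s)) < 1 - eta.
  move: etaS; rewrite pow2 /bp_space -/s mulNr -mulrA divfK ?gt_eqF //; lra.
have etan' : expR (- (delta * n%:R)) < 1 - eta.
  apply: (@le_lt_trans _ _ (2 `^ (- (delta * n%:R)))); last by lra.
  rewrite pow2 ler_expR mulNr lerN2; apply: ler_piMr => //.
  by apply: mulr_ge0; exact: ltW.
have TS' : (bp_time B)%:R * s < c * n%:R ^+ 2.
  apply: le_lt_trans TS; apply: ler_wpM2l => //.
  by rewrite /bp_space -/s ler_pdivlMr //; apply: ler_piMr.
have {}bound t m W := bound n (F n) B t m W (@Fp n) (@Fm n) (@Fn n) Gn.
(* A program with at most n/8 queries is one stage and contradicts the bound on [eta] in terms of n.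
   A longer one is cut into t stages and contradicts the bound in terms of S. *)
have [Tq|qT] := leqP (bp_time B) (n %/ 8).
  have mG : (n <= 2 * (n %/ G) * G)%N by apply: leq_double_divn; rewrite G0.
  have := bound 1%N (n %/ G)%N [set bp_source B] isT.
  rewrite !mul1n leq_trunc_div cards1 mul1r => /(_ Tq isT) bd.
  have nm : n%:R <= 2 * (n %/ G)%:R * G%:R :> R by rewrite -!natrM ler_nat.
  have num := short _ nm.
  have bdE : 1 - bp_error B R (sliding_window (F n)) <=
      expR (- (n%:R / G%:R)) + expR (- ((n %/ G)%:R / 128)).
    by apply: bd => x [|i] // _; rewrite mul0n finset.in_set1 /=.
  lra.
pose T := bp_time B; pose q := (n %/ 8)%N; pose t := (T %/ q).+1; pose m := (n %/ (G * t))%N.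
have q0 : (0 < q)%N by rewrite /q divn_gt0 // (leq_trans G8).
have /andP[Tt tq] : (T <= t * q <= 2 * T)%N by apply: ceil_mul_bounds; rewrite q0 ltnW.
have tmG : (t * m * G <= n)%N by exact: mul_divn_mul_le.
have nm : (n <= m.+1 * (G * t))%N by apply/ltnW/ltn_ceil; rewrite muln_gt0 G0.
have := bound t m [set: bp_node B] isT Tt tmG (fun _ _ _ => finset.in_setT _).
rewrite cardsT -sE -expRD => bd.
have T0 : 0 < T%:R :> R by rewrite ltr0n (leq_ltn_trans _ qT).
have s2 : 1 / 2 <= s.
  apply: le_trans ln2l _; rewrite ler_ln ?posrE ?ltr0n // ler_nat.
  by apply: leq_ltn_trans (bp_time_lt B); apply: leq_ltn_trans qT.
have nq : n%:R <= 16 * q%:R :> R.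
  rewrite -natrM ler_nat (_ : 16 = 2 * 8)%N // -mulnA (mulnC 8) mulnA.
  by apply: leq_double_divn; rewrite (leq_trans G8).
have qT' : q%:R <= T%:R :> R by rewrite ler_nat ltnW.
have tq' : t%:R * q%:R <= 2 * T%:R :> R by rewrite -!natrM ler_nat.
have nm' : n%:R <= (m%:R + 1) * (G%:R * t%:R) :> R by rewrite natr1 -!natrM ler_nat.
have := long _ _ _ _ _ T0 (ler0n _ m) s2 nq qT' tq' nm' TS'.
lra.
Qed.

Theorem theorem9 (R : realType) :
  (forall k : nat, (k = 0 \/ 2 <= k)%N ->
     exists delta : R, 0 < delta /\
       sliding_TS_lower_bound (fun n (a : seq 'I_n) => freq_moment k a) delta)
  /\
  (exists delta : R, 0 < delta /\
     sliding_TS_lower_bound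
       (fun n (a : seq 'I_n) => (freq_moment 0 a %% 2)%N) delta).
Proof.
have [delta delta0 H] := sliding_TS_lower_bound_uniform R.
split=> [k hk|]; exists delta; split=> //; apply: H.
- by move=> n a b; exact: freq_moment_perm.
- by move=> n s a; exact: freq_moment_map.
- move=> n u v a uv ua va.
  rewrite freq_moment_cons_distinct // freq_moment_cons_double // eqn_add2r.
  case: hk => [->//|k2]; rewrite neq_ltn; apply/orP; left.
  by rewrite -[X in (X < _)%N]expn1 ltn_exp2l.
- by move=> n a b /freq_moment_perm ->.
- by move=> n s a /freq_moment_map ->.
- move=> n u v a uv ua va.
  rewrite freq_moment_cons_distinct // freq_moment_cons_double // expn0.
  by apply/eqP; lia.
Qed.
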